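(* Let $p\in\mathbb N$ be fixed. Let $(Y(n))_{n\in\mathbb N}$ be complex $n\times n$ random matrices such that, for each $n$, $\{\mathrm{Re}\,Y_{i,j}(n),\mathrm{Im}\,Y_{i,j}(n):i,j\in[n]\}$ are independent Gaussian random variables with zero mean and variances $\mathbb E((\mathrm{Re}\,Y_{i,j}(n))^2)=\mathbb E((\mathrm{Im}\,Y_{i,j}(n))^2)=v_{a,b}/2n$ for $(i,j)\in N_a\times N_b$, $a,b\in[p+1]$, where the matrix $(v_{a,b})$ is symmetric. Suppose that $v_{j,j+1}=1$ for $j\in[p]$, and let $$B(n)=T_{1,2}(n)T_{2,3}(n)\cdots T_{p,p+1}(n)$$ for any natural $n$. Then, for any nonnegative integer $k$, $$\lim_{n\to\infty}\tau_1(n)\big((B(n)B^*(n))^k\big)=P_k(d_1,d_2,\dots,d_{p+1}),$$ where $d_1,\dots,d_{p+1}$ are the asymptotic dimensions.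
   Context: For each $n$ let $[n]=\{1,\dots,n\}$ be partitioned into disjoint nonempty intervals $N_1,\dots,N_{p+1}$ (depending on $n$), $n_q=|N_q|$, with asymptotic dimensions $d_q=\lim_{n\to\infty}n_q/n\ge0$. $D_q$ is the $n\times n$ diagonal matrix with $(D_q)_{j,j}=1$ if $j\in N_q$ and all other entries $0$. $T_{j,j+1}(n)=D_jY(n)D_{j+1}+D_{j+1}Y(n)D_j$ (symmetric blocks of $Y(n)$). $\tau_1(n)(A)=\frac1{n_1}\mathbb E\sum_{j\in N_1}A_{j,j}$. Polynomials $P_k$. Let $W_k=(1\,2\cdots p\,p^*\cdots 2^*1^* )^k$, a word of length $2kp$ in the letters $1,\dots,p,1^*,\dots,p^*$. Let $\mathcal{NC}^2(W_k)$ be the set of noncrossing pair partitions $\pi$ of $\{1,\dots,2kp\}$ such that the two positions of every block carry letters $j$ and $j^*$ for some $j\in[p]$ (in either order). For $\pi\in\mathcal{NC}^2(W_k)$ let $\mathcal R_j(\pi)$ and $\mathcal R_j^*(\pi)$ be the sets of right legs (larger elements of blocks) of $\pi$ which carry the letter $j$ and $j^*$, respectively, with $\mathcal R_0^*(\pi)=\emptyset$ and $\mathcal R_{p+1}(\pi)=\emptyset$. Put $r_j(\pi)=|\mathcal R_j(\pi)|+|\mathcal R_{j-1}^*(\pi)|$ for $1\le j\le p+1$ and $$P_k(d_1,\dots,d_{p+1})=\sum_{\pi\in\mathcal{NC}^2(W_k)}d_1^{\,r_1(\pi)}d_2^{\,r_2(\pi)}\cdots d_{p+1}^{\,r_{p+1}(\pi)},$$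 with $P_0=1$. *)

(* Defs.v *)
From HB Require Import structures.
From mathcomp Require Import all_boot all_order all_algebra.
From mathcomp Require Import all_classical all_reals all_analysis.
From mathcomp Require Import complex.

Set Implicit Arguments.
Unset Strict Implicit.
Unset Printing Implicit Defensive.

Import Order.TTheory GRing.Theory Num.Theory.
Import numFieldNormedType.Exports.

Local Open Scope classical_set_scope.
Local Open Scope ring_scope.
Local Open Scope complex_scope.

(* Rows, columns and blocks are counted from 0: the index i : 'I_n stands for
   i + 1 in [n], and the block N q with q : 'I_p.+1 stands for N_{q+1}. *)

Section Blocks.
Variables (n m : nat).

(* The blocks are not required to follow one another in the order of their
   labels. *)
Definition interval_partition (N : 'I_m -> {set 'I_n}) : Prop :=
  [/\ forall q, N q != finset.set0,
      forall q q', q != q' -> N q :&: N q' = finset.set0,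
      forall i, exists q, i \in N q
    & forall q (i j k : 'I_n),
        i \in N q -> k \in N q -> (i <= j <= k)%N -> j \in N q].

End Blocks.

Section Probability.
Context {d : measure_display} {T : measurableType d} {R : realType}.
Variable P : probability T R.

(* A variance may be 0, and then the law is the point mass at 0; [normal_prob]
   does not cover this case. *)
Definition centered_gaussian (s2 : R) (A : set R) : \bar R :=
  if s2 == 0 then \d_(0 : R) A else normal_prob 0 (Num.sqrt s2) A.

Definition is_centered_gaussian (X : T -> R) (s2 : R) : Prop :=
  [/\ measurable_fun [set: T] X, 0 <= s2
    & forall A : set R, measurable A ->
        P (X @^-1` A) = centered_gaussian s2 A].

Definition independent_family (I : finType) (X : I -> T -> R) : Prop :=
  forall (J : {set I}) (A : I -> set R), (forall i, measurable (A i)) ->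
    P (\bigcap_(i in [set` J]) (X i @^-1` A i)) =
    (\prod_(i in J) P (X i @^-1` A i))%E.

Definition complex_expectation (Z : T -> R[i]) : R[i] :=
  (fine 'E_P[fun w => complex.Re (Z w)]) +i*
  (fine 'E_P[fun w => complex.Im (Z w)]).

Definition entry_part n (Y : T -> 'M[R[i]]_n) (c : 'I_n * 'I_n * bool) (w : T) : R :=
  let z := Y w c.1.1 c.1.2 in if c.2 then complex.Im z else complex.Re z.

Definition gaussian_block_matrix n m (N : 'I_m -> {set 'I_n}) (v : 'M[R]_m)
    (Y : T -> 'M[R[i]]_n) : Prop :=
  independent_family (entry_part Y) /\
  forall (a b : 'I_m) (i j : 'I_n) (c : bool), i \in N a -> j \in N b ->
    is_centered_gaussian (entry_part Y (i, j, c)) (v a b / (2 * n)%:R).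

(* The normalized partial trace tau over the set S of diagonal positions. *)
Definition partial_trace n (S : {set 'I_n}) (A : T -> 'M[R[i]]_n) : R[i] :=
  #|S|%:R^-1 * complex_expectation (fun w => \sum_(j in S) A w j j).

End Probability.

Section Matrices.
Variables (R : realType) (n p : nat) (N : 'I_p.+1 -> {set 'I_n}).

Definition block_proj (q : 'I_p.+1) : 'M[R[i]]_n :=
  diag_mx (\row_i (i \in N q)%:R).

Definition sym_block (Y : 'M[R[i]]_n) (a b : 'I_p.+1) : 'M[R[i]]_n :=
  block_proj a *m Y *m block_proj b + block_proj b *m Y *m block_proj a.

Definition block_product (Y : 'M[R[i]]_n) : 'M[R[i]]_n :=
  \prod_(j < p) sym_block Y (widen_ord (leqnSn p) j) (lift ord0 j).

End Matrices.

Section Words.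
Variables (p k : nat).

(* The letter j is (j, false) and the letter j^* is (j, true), for
   1 <= j <= p. *)
Definition word : seq (nat * bool) :=
  flatten (nseq k ([seq (j, false) | j <- iota 1 p] ++
                   [seq (j, true) | j <- rev (iota 1 p)])).

Lemma size_word : size word = (2 * k * p)%N.
Proof.
rewrite size_flatten /shape map_nseq sumn_nseq size_cat !size_map size_rev.
by rewrite size_iota addnn -mul2n mulnAC.
Qed.

Definition letter (i : 'I_(2 * k * p)) : nat * bool := nth (0%N, false) word i.

Definition is_pair_partition (pi : {set {set 'I_(2 * k * p)}}) : bool :=
  finset.partition pi [set: 'I_(2 * k * p)]%SET && [forall V in pi, #|V| == 2%N].

Definition crossing (V W : {set 'I_(2 * k * p)}) : bool :=
  [exists a in V, exists b in W, exists c in V, exists e in W,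
     (a < b)%N && (b < c)%N && (c < e)%N].

Definition noncrossing (pi : {set {set 'I_(2 * k * p)}}) : bool :=
  [forall V in pi, forall W in pi, (V != W) ==> ~~ crossing V W].

Definition adapted (pi : {set {set 'I_(2 * k * p)}}) : bool :=
  [forall V in pi, forall i in V, forall j in V, (i != j) ==>
     ((letter i).1 == (letter j).1) && ((letter i).2 != (letter j).2)].

Definition NC2 : {set {set {set 'I_(2 * k * p)}}} :=
  [set pi | [&& is_pair_partition pi, noncrossing pi & adapted pi]]%SET.

Definition right_legs (pi : {set {set 'I_(2 * k * p)}}) (l : nat * bool) :
    {set 'I_(2 * k * p)} :=
  [set i | (letter i == l) &&
           [exists V in pi, (i \in V) && [exists j in V, (j < i)%N]]]%SET.

(* The letters 0^* and p + 1 do not occur in the word, so that the first term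
   vanishes for j = p + 1 and the second one for j = 1. *)
Definition leg_count (pi : {set {set 'I_(2 * k * p)}}) (j : nat) : nat :=
  (#|right_legs pi (j, false)| + #|right_legs pi (j.-1, true)|)%N.

Definition moment_poly (R : realType) (d : 'I_p.+1 -> R) : R :=
  \sum_(pi in NC2) \prod_(q < p.+1) d q ^+ leg_count pi q.+1.

End Words.

(* Main.v *)
(** Expand along blocks: B(n)B^*(n) acts on N_1 as a product of rectangular
    Gaussian blocks along the closed walk W_k on the blocks. Gaussian integration
    by parts, applied to the first letter of a product of normalized traces of
    closed walks, gives a loop equation: that letter is contracted with an adjoint
    letter, so that its trace splits into two traces (with a factor n_q / n), or
    is merged with another trace (with a vanishing factor). By induction on the
    total length, expectations of products of traces converge to products of
    numbers satisfying the planar recursion "first letter, its partner, what is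
    inside, what is outside"; this recursion also computes the weighted sum over
    noncrossing pairings of W_k, each pair contributing the dimension of the block
    at which its right leg starts. *)

Require Import Defs.
From HB Require Import structures.
From mathcomp Require Import all_boot all_order all_algebra.
From mathcomp Require Import all_classical all_reals all_analysis.
From mathcomp Require Import measurable_realfun.
From mathcomp Require Import complex ring lra zify.

Set Implicit Arguments.
Unset Strict Implicit.
Unset Printing Implicit Defensive.

Import Order.TTheory GRing.Theory Num.Theory.
Import numFieldNormedType.Exports.

Local Open Scope classical_set_scope.
Local Open Scope ring_scope.
Local Open Scope complex_scope.
Local Open Scope sesquilinear_scope.


(** * Transfer of integrals along laws *)

(** The loop equation does not close on a single trace: a split gives the expectation of a product
    of two traces, which does not factor at finite size. The induction therefore carries products of
    arbitrarily many traces, and asymptotic factorization comes out of it without any variance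
    estimate. The merging coefficient [n^-1 / #|N q|] is at most [n^-1] because blocks are nonempty,
    so a dimension [d q = 0] causes no trouble. Integration by parts is proved for polynomials in
    the real and imaginary parts of the entries, starting from moments. The hypotheses speak of
    probabilities of events only, so identities on indicators are first extended to integrals
    carrying a weight. The weight serves twice: as the Gaussian density, and as the product of the
    remaining factors in the proof of independence. A variance may be 0, hence a separate Dirac
    case. *)

Section WeightedTransfer.
Context d1 d2 d (T1 : measurableType d1) (T2 : measurableType d2)
  (U : measurableType d) (R : realType).
Variables (mu1 : {measure set T1 -> \bar R}) (mu2 : {measure set T2 -> \bar R}).
Variables (X1 : T1 -> U) (X2 : T2 -> U) (G1 : T1 -> R) (G2 : T2 -> R).
Hypotheses (mX1 : measurable_fun setT X1) (mX2 : measurable_fun setT X2).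
Hypotheses (mG1 : measurable_fun setT G1) (mG2 : measurable_fun setT G2).
Hypotheses (G1_ge0 : forall x, 0 <= G1 x) (G2_ge0 : forall x, 0 <= G2 x).
Hypothesis eq_indic : forall A, measurable A ->
  (\int[mu1]_x (G1 x * \1_A (X1 x))%:E = \int[mu2]_x (G2 x * \1_A (X2 x))%:E)%E.

Import HBNNSimple.

Let weighted_nnsfun d' (T : measurableType d') (mu : {measure set T -> \bar R})
    (X : T -> U) (G : T -> R) (f : {nnsfun U >-> R}) :
  measurable_fun setT X -> measurable_fun setT G -> (forall x, 0 <= G x) ->
  (\int[mu]_x (G x * f (X x))%:E =
   \sum_(k \in range f) k%:E * \int[mu]_x (G x * \1_(f @^-1` [set k]) (X x))%:E)%E.
Proof.
move=> mX mG G0.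
have mI k : measurable_fun setT (fun x => G x * \1_(f @^-1` [set k]) (X x)).
  by apply: measurable_funM => //; apply: measurableT_comp => //.
have E x : (G x * f (X x))%:E =
    (\sum_(k \in range f) (k * (G x * \1_(f @^-1` [set k]) (X x)))%:E)%E.
  rewrite (fimfunE f (X x)) fsbig_finite//= fsbig_finite//= mulr_sumr -sumEFin.
  by apply: eq_bigr => k _; rewrite mulrCA.
under eq_integral do rewrite E.
have nn k x : (0 <= (k * (G x * \1_(f @^-1` [set k]) (X x)))%:E)%E.
  by rewrite mulrCA EFinM mule_ge0 ?lee_fin// -lee_fin nnfun_muleindic_ge0.
rewrite ge0_integral_fsum//; last first.
  by move=> k; apply/measurable_EFinP; apply: measurable_funM.
apply: eq_fsbigr => k /[!inE] -[y _ <-].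
under eq_integral do rewrite EFinM.
rewrite ge0_integralZl//; first exact/measurable_EFinP.
- by move=> x _; rewrite lee_fin mulr_ge0// indicE.
- by rewrite lee_fin.
Qed.

Let weighted_lim d' (T : measurableType d') (mu : {measure set T -> \bar R})
    (X : T -> U) (G : T -> R) (f : U -> R) (mf : measurable_fun setT (EFin \o f)) :
  (forall x, 0 <= f x) ->
  measurable_fun setT X -> measurable_fun setT G -> (forall x, 0 <= G x) ->
  (\int[mu]_x (G x * f (X x))%:E =
   limn (fun n => \int[mu]_x (G x * nnsfun_approx measurableT mf n (X x))%:E))%E.
Proof.
move=> f0 mX mG G0.
rewrite -monotone_convergence//.
- apply: eq_integral => x _; apply/esym/cvg_lim => //.
  rewrite (_ : (fun n => _) = (fun n => (G x)%:E *
    (EFin \o (nnsfun_approx measurableT mf)^~ (X x)) n)%E); last first.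
    by apply/funext => n; rewrite EFinM.
  rewrite EFinM; apply: cvgeZl => //.
  by apply: (cvg_nnsfun_approx measurableT mf) => // y _; rewrite /= lee_fin.
- move=> n; apply/measurable_EFinP; apply: measurable_funM => //.
  exact: measurableT_comp.
- by move=> n x _; rewrite lee_fin mulr_ge0.
- move=> x _ m n mn; rewrite lee_fin ler_wpM2l//.
  exact/lefP/nd_nnsfun_approx.
Qed.

(** Both sides are additive and continuous along increasing sequences, so equality on indicators
    passes to simple functions and then to their limits. *)
Lemma ge0_integral_weighted_transfer (f : U -> R) :
  measurable_fun setT f -> (forall x, 0 <= f x) ->
  (\int[mu1]_x (G1 x * f (X1 x))%:E = \int[mu2]_x (G2 x * f (X2 x))%:E)%E.
Proof.
move=> /measurable_EFinP mf f0; rewrite !(weighted_lim _ mf)//.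
congr (limn _); apply/funext => n.
rewrite !weighted_nnsfun//; apply: eq_fsbigr => k _; congr (_ * _)%E.
by rewrite eq_indic.
Qed.

Lemma integrable_weighted_transfer (f : U -> R) : measurable_fun setT f ->
  mu2.-integrable setT (EFin \o (fun x => G2 x * f (X2 x))) ->
  mu1.-integrable setT (EFin \o (fun x => G1 x * f (X1 x))).
Proof.
move=> mf /integrableP[_ foo]; apply/integrableP; split.
  by apply/measurable_EFinP; apply: measurable_funM => //; exact: measurableT_comp.
rewrite (_ : (\int[mu1]_x _ = \int[mu1]_x (G1 x * `|f (X1 x)|)%:E)%E); last first.
  by apply: eq_integral => x _; rewrite abse_EFin normrM ger0_norm.
rewrite (ge0_integral_weighted_transfer (f := fun x => `|f x|))//; last exact: measurableT_comp.
apply: le_lt_trans foo; rewrite le_eqVlt; apply/orP; left; apply/eqP.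
by apply: eq_integral => x _; rewrite abse_EFin normrM ger0_norm.
Qed.

(** Positive and negative parts are transferred separately; integrability on the [mu1] side is
    itself obtained by transferring [|f|]. *)
Lemma integral_weighted_transfer (f : U -> R) : measurable_fun setT f ->
  mu2.-integrable setT (EFin \o (fun x => G2 x * f (X2 x))) ->
  (\int[mu1]_x (G1 x * f (X1 x))%:E = \int[mu2]_x (G2 x * f (X2 x))%:E)%E.
Proof.
move=> mf if2; have if1 := integrable_weighted_transfer mf if2.
have mp := measurable_funrpos mf; have mn := measurable_funrneg mf.
have split_ d' (T : measurableType d') (mu : {measure set T -> \bar R})
    (X : T -> U) (G : T -> R) : measurable_fun setT X -> measurable_fun setT G ->
    (forall x, 0 <= G x) ->
    mu.-integrable setT (EFin \o (fun x => G x * f (X x))) ->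
    (\int[mu]_x (G x * f (X x))%:E = \int[mu]_x (G x * f^\+ (X x))%:E
       - \int[mu]_x (G x * f^\- (X x))%:E)%E.
  move=> mX mG G0 ifX.
  rewrite -integralB_EFin//=.
  - apply: eq_integral => x _; rewrite -EFinB -mulrBr; congr (_ * _)%:E.
    by have /(congr1 (@^~ (X x))) := funrposBneg f.
  - apply: le_integrable ifX => //.
      by apply/measurable_EFinP; apply: measurable_funM => //; exact: measurableT_comp.
    move=> x _; rewrite !abse_EFin lee_fin !normrM ler_wpM2l// ger0_norm ?funrpos_ge0//.
    by rewrite ge_max ler_norm normr_ge0.
  - apply: le_integrable ifX => //.
      by apply/measurable_EFinP; apply: measurable_funM => //; exact: measurableT_comp.
    move=> x _; rewrite !abse_EFin lee_fin !normrM ler_wpM2l// ger0_norm ?funrneg_ge0//.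
    by rewrite ge_max ler_normr lexx orbT normr_ge0.
rewrite !split_//; congr (_ - _)%E; apply: ge0_integral_weighted_transfer => //.
Qed.

End WeightedTransfer.

(** * Gaussian moments *)

Section GaussianMoments.
Variable R : realType.
Implicit Types (s x : R) (m : nat).
Local Notation mu := (@lebesgue_measure R).

(** With [t = x^2 / (4 s^2)] the Gaussian is [expR (- t) * expR (- t)]: one factor absorbs the
    power, the other is the Gaussian of deviation [sqrt 2 * s]. The constant comes from
    [t^m <= m! * expR t]. *)
Lemma powX_normal_fun_le s m : s != 0 ->
  exists C, forall x, `|x| ^+ m * normal_fun 0 s x <= C * normal_fun 0 (Num.sqrt 2 * s) x.
Proof.
move=> s0; have s2 : 0 < s ^+ 2 by rewrite exprn_even_gt0.
exists (1 + (4 * s ^+ 2) ^+ m * (m`!)%:R) => x.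
pose t := x ^+ 2 / (4 * s ^+ 2).
have t0 : 0 <= t by rewrite divr_ge0 ?sqr_ge0// mulr_ge0// ltW.
have -> : normal_fun 0 s x = expR (- t) * expR (- t).
  rewrite -expRD /normal_fun subr0; congr expR; rewrite /t.
  by rewrite -mulr_natr; field.
have -> : normal_fun 0 (Num.sqrt 2 * s) x = expR (- t).
  rewrite /normal_fun subr0; congr expR; rewrite /t exprMn sqr_sqrtr//.
  by rewrite -mulr_natr; field.
rewrite mulrA ler_wpM2r ?expR_ge0//.
rewrite expRN ler_pdivrMr ?expR_gt0//.
(* The crude bound [y <= 1 + y^2] for [y = |x|^m] produces a power of [t] without square roots when
   [m] is odd. *)
have xm : `|x| ^+ m <= 1 + (4 * s ^+ 2) ^+ m * t ^+ m.
  have -> : (4 * s ^+ 2) ^+ m * t ^+ m = (`|x| ^+ m) ^+ 2.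
    rewrite -exprMn /t mulrC divfK ?gt_eqF//; last exact: mulr_gt0.
    by rewrite -exprM mulnC exprM real_normK ?num_real.
  have := sqr_ge0 (`|x| ^+ m - 1); have := sqr_ge0 (`|x| ^+ m); rewrite sqrrB1; lra.
apply: le_trans xm _; rewrite [leRHS]mulrDl mul1r.
apply: lerD; first by rewrite -expR0 ler_expR.
rewrite -mulrA; apply: ler_wpM2l; first by rewrite exprn_ge0// mulr_ge0// ltW.
case: m => [|m]; first by rewrite expr0 fact0 mul1r -expR0 ler_expR.
have h := @expR_ge1Dxn R t m t0.
rewrite -ler_pdivrMl ?ltr0n ?fact_gt0// mulrC; apply: le_trans h.
by rewrite lerDr.
Qed.

Lemma powX_normal_fun_bounded s m : s != 0 ->
  exists C, forall x, `|x| ^+ m * normal_fun 0 s x <= C.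
Proof.
move=> s0; have [C hC] := powX_normal_fun_le m s0; exists `|C| => x.
apply: le_trans (hC x) _; apply: le_trans (ler_norm _) _.
rewrite normrM ler_piMr// ger0_norm ?expR_ge0// -[leRHS]expR0 ler_expR.
by rewrite mulNr oppr_le0 divr_ge0 ?sqr_ge0// mulrn_wge0// sqr_ge0.
Qed.

Lemma cvg_powX_normal_fun s m : s != 0 ->
  (n%:R ^+ m * normal_fun 0 s n%:R @[n --> \oo] --> (0 : R)).
Proof.
(* The bound for the power [m.+1] leaves a spare factor [n], so the sequence is at most [C / n]. *)
move=> s0; have [C hC] := powX_normal_fun_bounded m.+1 s0.
apply/cvgr0Pnorm_le => e e0.
near=> n.
have n0 : (0 : R) < n%:R by rewrite ltr0n; near: n; exact: nbhs_infty_gt.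
rewrite ger0_norm ?mulr_ge0 ?exprn_ge0 ?expR_ge0//.
rewrite -(ler_pM2l n0) mulrA -exprS; apply: le_trans (_ : C <= _).
  by apply: le_trans (hC n%:R); rewrite ger0_norm.
rewrite -ler_pdivrMr//.
near: n; exact: nbhs_infty_ger.
Unshelve. all: by end_near.
Qed.

Lemma integrable_powX_normal_fun s m : s != 0 ->
  mu.-integrable setT (fun x => (x ^+ m * normal_fun 0 s x)%:E).
Proof.
move=> s0; have [C hC] := powX_normal_fun_le m s0.
have t0 : Num.sqrt 2 * s != 0 by rewrite mulf_neq0// gt_eqF// sqrtr_gt0.
have mg : measurable_fun setT (fun x : R => x ^+ m * normal_fun 0 s x).
  by apply: measurable_funM; [exact: measurable_funX|exact: measurable_normal_fun].
apply: (@le_integrable _ _ _ mu setT measurableT _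
   (fun x => (`|C| / normal_peak (Num.sqrt 2 * s))%:E *
             (normal_pdf 0 (Num.sqrt 2 * s) x)%:E)%E).
- exact/measurable_EFinP.
- move=> x _; rewrite -EFinM !abse_EFin lee_fin normal_pdfE// mulrA.
  rewrite divfK ?gt_eqF ?normal_peak_gt0//.
  rewrite [leLHS]normrM [`|x ^+ m|]normrX [X in _ * X <= _]ger0_norm ?expR_ge0//.
  apply: le_trans (hC x) _; apply: le_trans (ler_norm _) _.
  by rewrite !normrM normr_id.
- by apply: integrableZl => //; exact: integrable_normal_pdf.
Qed.

Lemma is_derive_normal_fun (s x : R) : s != 0 ->
  is_derive x 1 (normal_fun 0 s) (- (x / s ^+ 2) * normal_fun 0 s x).
Proof.
move=> s0; pose q : {poly R} := - (s ^+ 2 *+ 2)^-1 *: 'X^2.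
have -> : normal_fun 0 s = expR \o horner q.
  apply/funext => y; rewrite /normal_fun /= subr0; congr expR.
  by rewrite /q hornerZ hornerXn mulNr mulNr mulrC.
rewrite mulrC; apply: is_derive1_comp.
rewrite (_ : - _ = q^`().[x]); first exact: is_derive_poly.
rewrite /q derivZ derivXn hornerZ hornerMn hornerX -[s ^+ 2 *+ 2]mulr_natr -[x *+ 2]mulr_natr.
by field.
Qed.

Lemma is_derive_powX_normal_fun (s x : R) m : s != 0 ->
  is_derive x 1 (fun x => x ^+ m * normal_fun 0 s x)
    (m%:R * x ^+ m.-1 * normal_fun 0 s x - s ^- 2 * (x ^+ m.+1 * normal_fun 0 s x)).
Proof.
move=> s0.
have d1 : is_derive x 1 (horner 'X^m) ('X^m^`().[x]) by exact: is_derive_poly.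
have d2 := is_derive_normal_fun x s0.
have := is_deriveM d1 d2.
rewrite (_ : horner 'X^m * normal_fun 0 s = (fun x => x ^+ m * normal_fun 0 s x)); last first.
  by apply/funext => y; rewrite -[y ^+ m](hornerXn y m).
move/is_derive_eq; apply.
move: (normal_fun 0 s x) => g; rewrite hornerXn derivXn hornerMn hornerXn -mulr_natr (exprS x).
rewrite /GRing.scale/=; field.
exact: s0.
Qed.

(** On [[- n, n]] the fundamental theorem gives [F n - F (- n)], which tends to 0; dominated
    convergence, with [|f|] as dominating function, identifies the limit with the whole integral. *)
Lemma integral_derive_eq0 (F f : R -> R) :
  continuous f -> (forall x : R, is_derive x 1 F (f x)) ->
  mu.-integrable setT (EFin \o f) ->
  F n%:R @[n --> \oo] --> (0 : R) -> F (- n%:R) @[n --> \oo] --> (0 : R) ->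
  (\int[mu]_x (f x)%:E = 0)%E.
Proof.
move=> cf dF intf F1 F2.
pose D (n : nat) := `[- (n%:R : R), n%:R]%classic.
have mf : measurable_fun setT (EFin \o f) := measurable_int _ intf.
have mD n : measurable (D n) by exact: measurable_itv.
pose fn n := (EFin \o f) \_ (D n).
have mfn n : measurable_fun setT (fn n).
  by apply/(measurable_restrictT _ (mD n)); exact: measurable_funTS.
have cfn : {ae mu, forall x, setT x -> fn ^~ x @ \oo --> (EFin \o f) x}.
  apply: aeW => x _; apply: cvg_near_cst.
  near=> n; rewrite /fn patchE mem_set// /D /= in_itv /= -ler_norml.
  by near: n; exact: nbhs_infty_ger.
have bfn : {ae mu, forall x n, setT x -> (`|fn n x| <= `|(EFin \o f) x|)%E}.
  by apply: aeW => x n _; rewrite /fn patchE; case: ifP => // _; rewrite abse0.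
have [_ _ L] := @dominated_convergence _ _ _ mu setT measurableT fn
  (EFin \o f) _ mfn mf cfn (integrable_abse intf) bfn.
have E n : (0 < n)%N -> (\int[mu]_x fn n x)%E = (F n%:R - F (- n%:R))%:E.
  move=> n0; rewrite /fn -integral_mkcond EFinB; apply: continuous_FTC2.
  - by rewrite -subr_gt0 opprK addr_gt0// ltr0n.
  - exact: continuous_subspaceT.
  - have cF x : {for x, continuous F}.
      by apply: differentiable_continuous; apply/derivable1_diffP; case: (dF x).
    split; first by move=> x _; case: (dF x).
      by apply: cvg_at_right_filter; exact: cF.
    by apply: cvg_at_left_filter; exact: cF.
  - by move=> x _; rewrite derive1E; exact: derive_val.
have L0 : [sequence (\int[mu]_x fn n x)%E]_n @ \oo --> (0%:E : \bar R).
  have FF : F n%:R - F (- n%:R) @[n --> \oo] --> (0 - 0 : R) by exact: cvgB.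
  rewrite subr0 in FF; apply/fine_cvgP; split.
    by near=> n; rewrite /= E//; near: n; exact: nbhs_infty_gt.
  apply: cvg_trans FF; apply: near_eq_cvg.
  by near=> n; rewrite /= E//; near: n; exact: nbhs_infty_gt.
by have /= <- := cvg_unique _ L0 L.
Unshelve. all: by end_near.
Qed.

End GaussianMoments.

(** * Moments of one variable, derived from its law *)

Section GaussianVariable.
Context d (T : measurableType d) (R : realType) (P : probability T R).
Variables (X : T -> R) (s2 : R).
Hypothesis gX : is_centered_gaussian P X s2.

Let mX : measurable_fun setT X. Proof. by case: gX. Qed.

(** The weight 1 is written out to fit the transfer lemmas: a zero variance transfers to the Dirac
    mass at 0, a positive one, in [normal_law], to Lebesgue measure weighted by the density. *)
Let degenerate_law : s2 = 0 -> forall A, measurable A ->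
  (\int[P]_x (1 * \1_A (X x))%:E = \int[\d_(0%R : R)]_x (1 * \1_A x)%:E)%E.
Proof.
move=> s20 A mA; have [_ _ hX] := gX.
under eq_integral do rewrite mul1r.
under [RHS]eq_integral do rewrite mul1r.
have mXA : measurable (X @^-1` A) by rewrite -[_ @^-1` _]setTI; exact: mX.
rewrite (integral_indic P measurableT mXA) (integral_indic _ measurableT mA) !setIT.
by have := hX A mA; rewrite /centered_gaussian s20 eqxx.
Qed.

Let normal_law : s2 != 0 -> forall A, measurable A ->
  (\int[P]_x (1 * \1_A (X x))%:E =
   \int[lebesgue_measure]_x (normal_pdf 0 (Num.sqrt s2) x * \1_A x)%:E)%E.
Proof.
move=> s20 A mA; have [_ _ hX] := gX.
under eq_integral do rewrite mul1r.
have mXA : measurable (X @^-1` A) by rewrite -[_ @^-1` _]setTI; exact: mX.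
rewrite (integral_indic P measurableT mXA) setIT.
transitivity (normal_prob 0 (Num.sqrt s2) A).
  by have := hX A mA; rewrite /centered_gaussian (negbTE s20).
rewrite /normal_prob integral_mkcond; apply: eq_integral => x _.
by rewrite patchE indicE; case: ifP => _; rewrite ?mulr1 ?mulr0.
Qed.

Let mpdf := @measurable_normal_pdf R 0 (Num.sqrt s2).
Let pdf0 := @normal_pdf_ge0 R 0 (Num.sqrt s2).
Let mid : measurable_fun setT (@id R). Proof. exact: measurable_id. Qed.
Let mexp m : measurable_fun setT (fun x : R => x ^+ m).
Proof. exact: measurable_funX. Qed.

Let integrable_powX_pdf m : s2 != 0 -> lebesgue_measure.-integrable setT
  (EFin \o (fun x => normal_pdf 0 (Num.sqrt s2) x * x ^+ m)).
Proof.
move=> s20; have [_ s2_ge0 _] := gX.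
have s0 : Num.sqrt s2 != 0 by rewrite gt_eqF// sqrtr_gt0 lt_neqAle eq_sym s20.
rewrite normal_pdfE// (_ : _ \o _ = (fun x => (normal_peak (Num.sqrt s2))%:E *
   (x ^+ m * normal_fun 0 (Num.sqrt s2) x)%:E)%E).
  by apply: integrableZl => //; exact: integrable_powX_normal_fun.
by apply/funext => x /=; rewrite -EFinM; congr (_%:E); rewrite -mulrA; congr (_ * _); exact: mulrC.
Qed.

Lemma integrable_gaussian_moment m :
  P.-integrable setT (EFin \o (fun w => X w ^+ m)).
Proof.
have -> : (fun w => X w ^+ m) = (fun w => 1 * X w ^+ m).
  by apply/funext => w; rewrite mul1r.
have [s20|s20] := eqVneq s2 0.
- apply: (@integrable_weighted_transfer _ _ _ _ _ _ _ _ _ X id (cst 1) (cst 1)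
    mX mid (measurable_cst _) (measurable_cst _) (fun=> ler01) (fun=> ler01)
    (degenerate_law s20) (fun x => x ^+ m) (mexp m)).
  apply/integrableP; split; first by apply/measurable_EFinP; exact: measurable_funM.
  rewrite integral_dirac//; first by rewrite diracT mul1e ltry.
  by apply: measurableT_comp => //; apply/measurable_EFinP; exact: measurable_funM.
- apply: (@integrable_weighted_transfer _ _ _ _ _ _ _ _ (@lebesgue_measure R) X id (cst 1) _
    mX mid (measurable_cst _) mpdf (fun=> ler01) pdf0 (normal_law s20) (fun x => x ^+ m) (mexp m)).
  exact: integrable_powX_pdf.
Qed.

Let degenerate_moment m : s2 = 0 -> \int[P]_w (X w ^+ m) = 0 ^+ m.
Proof.
move=> s20; rewrite /Rintegral.
under eq_integral do rewrite -[_ ^+ m]mul1r.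
have mf : measurable_fun setT (fun x : R => (1 * x ^+ m)%:E).
  by apply/measurable_EFinP; exact: measurable_funM.
rewrite (@integral_weighted_transfer _ _ _ _ _ _ _ _ _ X id (cst 1) (cst 1)
    mX mid (measurable_cst _) (measurable_cst _) (fun=> ler01) (fun=> ler01)
    (degenerate_law s20) (fun x => x ^+ m) (mexp m)).
  by rewrite integral_dirac// diracT mul1e mul1r.
apply/integrableP; split => //.
by rewrite integral_dirac//; [rewrite diracT mul1e ltry|exact: measurableT_comp].
Qed.

Let normal_moment m : s2 != 0 -> \int[P]_w (X w ^+ m) =
  normal_peak (Num.sqrt s2) *
  \int[lebesgue_measure]_x (x ^+ m * normal_fun 0 (Num.sqrt s2) x).
Proof.
move=> s20; have [_ s2_ge0 _] := gX.
have s0 : Num.sqrt s2 != 0 by rewrite gt_eqF// sqrtr_gt0 lt_neqAle eq_sym s20.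
rewrite -RintegralZl//; last exact: integrable_powX_normal_fun.
rewrite /Rintegral; congr fine.
under eq_integral do rewrite -[_ ^+ m]mul1r.
rewrite (@integral_weighted_transfer _ _ _ _ _ _ _ _ (@lebesgue_measure R) X id (cst 1) _
    mX mid (measurable_cst _) mpdf (fun=> ler01) pdf0 (normal_law s20) (fun x => x ^+ m) (mexp m)).
  apply: eq_integral => x _; rewrite normal_pdfE// -mulrA; congr (_ * _)%:E.
  exact: mulrC.
exact: integrable_powX_pdf.
Qed.

(** Stein's identity for a power: the derivative of [x^m * normal_fun 0 s x] integrates to 0 and
    contains both moments. For [m = 0] the truncated [m.-1] is harmless, its coefficient being 0. *)
Lemma gaussian_moment_rec m :
  \int[P]_w (X w ^+ m.+1) = m%:R * s2 * \int[P]_w (X w ^+ m.-1).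
Proof.
have [s20|s20] := eqVneq s2 0.
  by rewrite degenerate_moment// s20 mulr0 mul0r expr0n.
have [_ s2_ge0 _] := gX.
have s0 : Num.sqrt s2 != 0 by rewrite gt_eqF// sqrtr_gt0 lt_neqAle eq_sym s20.
rewrite !normal_moment// mulrCA; congr (_ * _).
set s := Num.sqrt s2; have ss : s2 = s ^+ 2 by rewrite sqr_sqrtr.
pose f (x : R) := m%:R * x ^+ m.-1 * normal_fun 0 s x - s ^- 2 * (x ^+ m.+1 * normal_fun 0 s x).
pose mu := @lebesgue_measure R.
have i1 : mu.-integrable setT (EFin \o (fun x => m%:R * (x ^+ m.-1 * normal_fun 0 s x))).
  rewrite (_ : _ \o _ = (fun x => m%:R%:E * (x ^+ m.-1 * normal_fun 0 s x)%:E)%E)//.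
  by apply: integrableZl => //; exact: integrable_powX_normal_fun.
have i2 : mu.-integrable setT (EFin \o (fun x => s ^- 2 * (x ^+ m.+1 * normal_fun 0 s x))).
  rewrite (_ : _ \o _ = (fun x => (s ^- 2)%:E * (x ^+ m.+1 * normal_fun 0 s x)%:E)%E)//.
  by apply: integrableZl => //; exact: integrable_powX_normal_fun.
have ifE : EFin \o f = (fun x => (m%:R * (x ^+ m.-1 * normal_fun 0 s x))%:E -
     (s ^- 2 * (x ^+ m.+1 * normal_fun 0 s x))%:E)%E.
  by apply/funext => x; rewrite /f /= -mulrA EFinB.
have F_cvg : n%:R ^+ m * normal_fun 0 s n%:R @[n --> \oo] --> (0 : R).
  exact: cvg_powX_normal_fun.
have : (\int[mu]_x (f x)%:E = 0)%E.
  apply: (@integral_derive_eq0 _ (fun x => x ^+ m * normal_fun 0 s x)) => //.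
  - move=> x; apply: differentiable_continuous; apply/derivable1_diffP.
    have e1 := is_derive_powX_normal_fun x m.-1 s0.
    have e2 := is_derive_powX_normal_fun x m.+1 s0.
    suff -> : f = (m%:R \*: (fun x => x ^+ m.-1 * normal_fun 0 s x : R)) -
        (s ^- 2 \*: (fun x => x ^+ m.+1 * normal_fun 0 s x : R)).
      by have [] := is_deriveB (is_deriveZ m%:R e1) (is_deriveZ (s ^- 2) e2).
    by apply/funext => y; rewrite /f -mulrA.
  - by move=> x; exact: is_derive_powX_normal_fun.
  - by rewrite ifE; exact: integrableB.
  (* By parity the value at [- n] is the value at [n] times [(-1)^m], a factor independent of
     [n]. *)
  - rewrite (_ : (fun n => _) = (fun n : nat => (-1) ^+ m *
       (n%:R ^+ m * normal_fun 0 s n%:R))); last first.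
      apply/funext => n; rewrite mulrA; congr (_ * _); first exact: exprNn.
      by rewrite /normal_fun !subr0 -[X in X ^+ 2]mulN1r exprMn sqrrN expr1n mul1r.
    by rewrite -[X in _ --> X](mulr0 ((-1) ^+ m)); exact: cvgMr.
rewrite -[X in X -> _]/((\int[mu]_x (EFin \o f) x)%E = 0%E) ifE.
rewrite (integralB_EFin measurableT i1 i2) => H.
have := congr1 fine H; rewrite fineB ?integrable_fin_num//.
rewrite -[X in X - _]/(\int[mu]_x _) -[X in _ - X]/(\int[mu]_x _).
rewrite !RintegralZl//; try exact: integrable_powX_normal_fun.
move/eqP; rewrite /= subr_eq0 => /eqP e.
by rewrite [m%:R * s2]mulrC -mulrA e mulrA ss divff ?mul1r// sqrf_eq0.
Qed.

End GaussianVariable.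

(** * Independence and integration by parts *)

Section IndependentProducts.
Context d (T : measurableType d) (R : realType) (P : probability T R).
Variables (I : finType) (X : I -> T -> R).
Hypothesis indX : independent_family P X.
Hypothesis mX : forall i, measurable_fun setT (X i).
Implicit Types f : I -> R -> R.

Let admissible f := forall i, measurable_fun setT (f i) /\
  P.-integrable setT (EFin \o (f i \o X i)).

Let mprod f (D : pred I) : (forall i, measurable_fun setT (f i)) ->
  measurable_fun setT (fun w => \prod_(i | D i) f i (X i w)).
Proof.
move=> mf; rewrite (_ : (fun w => _) = (fun w =>
    \prod_(i <- [seq i <- index_enum I | D i]) f i (X i w))); last first.
  by apply/funext => w; rewrite big_filter.
apply: (measurable_prod (h := fun i w => f i (X i w))) => i _.
exact: measurableT_comp.
Qed.

(** Induction on a list [J] containing every index whose factor is not yet an indicator. For [J]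
    empty this is the independence of events; otherwise the factor at the head of [J] is first
    replaced by indicators and then recovered by transfer. *)
Let ge0_integral_prod (J : seq I) f : admissible f ->
  (forall i x, 0 <= f i x) ->
  (forall i, i \notin J -> exists2 A, measurable A & f i = \1_A) ->
  (\int[P]_w (\prod_i f i (X i w))%:E = (\prod_i \int[P]_w f i (X i w))%:E)%E.
Proof.
elim: J f => [|i0 J IH] f adf f0 indf.
  have /choice[A hA] : forall i, exists A, measurable A /\ f i = \1_A.
    by move=> i; have [A mA fA] := indf i isT; exists A.
  have mA i : measurable (A i) by have [] := hA i.
  have mXA i : measurable (X i @^-1` A i) by rewrite -[_ @^-1` _]setTI; exact: mX.
  have E i : (\int[P]_w f i (X i w))%:E = P (X i @^-1` A i).
    rewrite /Rintegral fineK; last by apply: integrable_fin_num => //; exact: (adf i).2.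
    have [_ ->] := hA i.
    by rewrite (integral_indic P measurableT (mXA i)) setIT.
  transitivity (\prod_(i in [set: I]%SET) P (X i @^-1` A i))%E; last first.
    rewrite -prodEFin; apply: eq_big => [i|i _]; last exact: esym (E i).
    by rewrite finset.in_setT.
  rewrite -indX//.
  have mcap : measurable (\bigcap_(i in [set` [set: I]%SET]) (X i @^-1` A i)).
    by apply: fin_bigcap_measurable => // i _.
  rewrite -[X in P X]setIT -(integral_indic P measurableT mcap).
  apply: eq_integral => w _; congr EFin; rewrite indicE.
  rewrite (eq_bigr (fun i => \1_(A i) (X i w))); last by move=> i _; have [_ ->] := hA i.
  have [wA|wA] := boolP (w \in _).
    rewrite big1// => i _; rewrite indicE mem_set//.
    by move: wA; rewrite inE => /(_ i); apply; exact: finset.in_setT.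
  have [i Ai] : exists i, ~ A i (X i w).
    apply/not_existsP => h; move/negP: wA; apply; rewrite inE => i _.
    by have /contrapT := h i.
  by rewrite (bigD1 i)//= indicE memNset// mul0r.
have [m0 int0] := adf i0.
pose f' A i := if i == i0 then \1_A else f i.
have adf' A : measurable A -> admissible (f' A).
  move=> mA i; rewrite /f'; case: eqP => [_|_]; last exact: adf.
  split; first exact: measurable_indic.
  have mXA : measurable (X i @^-1` A) by rewrite -[_ @^-1` _]setTI; exact: mX.
  exact: (integrable_indic _ mXA).
have eqG A w : \prod_i f' A i (X i w) =
    (\prod_(i | i != i0) f i (X i w)) * \1_A (X i0 w).
  rewrite (bigD1 i0)//= mulrC {2}/f' eqxx; congr (_ * _).
  by apply: eq_bigr => i ii0; rewrite /f' (negbTE ii0).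
have eqE A : \prod_i \int[P]_w f' A i (X i w) =
    (\prod_(i | i != i0) \int[P]_w f i (X i w)) * \int[P]_w \1_A (X i0 w).
  rewrite (bigD1 i0)//= mulrC {2}/f' eqxx; congr (_ * _).
  by apply: eq_bigr => i ii0; rewrite /f' (negbTE ii0).
rewrite [in RHS](bigD1 i0)//= mulrC.
pose c := \prod_(i | i != i0) \int[P]_w f i (X i w).
have c0 : 0 <= c by apply: prodr_ge0 => i _; apply: Rintegral_ge0 => w _.
(* By the induction hypothesis, against an indicator of [X i0] the product of the other factors may
   be replaced by the constant [c]. These two are the weights of the transfer that follows. *)
have eqind A : measurable A ->
    (\int[P]_w ((\prod_(i | i != i0) f i (X i w)) * \1_A (X i0 w))%:E =
     \int[P]_w (cst c w * \1_A (X i0 w))%:E)%E.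
  move=> mA.
  have mXA : measurable (X i0 @^-1` A) by rewrite -[_ @^-1` _]setTI; exact: mX.
  under eq_integral do rewrite -eqG.
  rewrite IH; last 3 first.
  - exact: adf'.
  - by move=> i x; rewrite /f'; case: ifP => _ //; rewrite indicE.
  - move=> i iJ; rewrite /f'; have [_|ii0] := eqVneq i i0; first by exists A.
    by apply: indf; rewrite inE negb_or ii0.
  under [RHS]eq_integral do rewrite EFinM.
  rewrite eqE EFinM integralZl//; last exact: (integrable_indic _ mXA).
  congr (_ * _)%E; rewrite /Rintegral fineK//.
  by apply: integrable_fin_num => //; exact: (integrable_indic _ mXA).
transitivity (\int[P]_w ((\prod_(i | i != i0) f i (X i w)) * f i0 (X i0 w))%:E)%E.
  by apply: eq_integral => w _; rewrite (bigD1 i0)//= mulrC.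
have G0 w : 0 <= \prod_(i | i != i0) f i (X i w) by apply: prodr_ge0.
have mG := @mprod f (fun i => i != i0) (fun i => (adf i).1).
rewrite (@ge0_integral_weighted_transfer _ _ _ _ _ _ _ P P (X i0) (X i0) _ (cst c)
   (mX i0) (mX i0) mG (measurable_cst _) G0 (fun=> c0) eqind (f i0) m0 (f0 i0)).
under eq_integral do rewrite EFinM.
rewrite integralZl//; rewrite EFinM; congr (_ * _)%E.
by rewrite /Rintegral fineK//; exact: integrable_fin_num.
Qed.

(** The nonnegative case, applied to absolute values, gives a finite integral. *)
Lemma integrable_indep_prod f : admissible f ->
  P.-integrable setT (EFin \o (fun w => \prod_i f i (X i w))).
Proof.
move=> adf.
have adN : admissible (fun i x => `|f i x|).
  move=> i; have [mf fi] := adf i; split; first exact: measurableT_comp.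
  exact: (integrable_abse fi).
have /= E := ge0_integral_prod (J := index_enum I) adN (fun i x => normr_ge0 _)
  (fun i => ltac:(by rewrite mem_index_enum)).
apply/integrableP; split; first by apply/measurable_EFinP; apply: mprod => i; exact: (adf i).1.
under eq_integral do rewrite /= normr_prod.
by rewrite E ltry.
Qed.

(** The same induction, where [J] now contains the indices whose factor may change sign; the head
    factor is split into positive and negative parts, and both sides are linear in it. *)
Let Rintegral_prod_signed (J : seq I) f : admissible f ->
  (forall i x, i \notin J -> 0 <= f i x) ->
  \int[P]_w (\prod_i f i (X i w)) = \prod_i \int[P]_w f i (X i w).
Proof.
elim: J f => [|i0 J IH] f adf fpos.
  have h := @ge0_integral_prod (index_enum I) f adf (fun i x => fpos i x isT)
    (fun i => ltac:(by rewrite mem_index_enum)).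
  by rewrite /Rintegral h.
pose f' g i := if i == i0 then g else f i.
have [m0 i0f] := adf i0.
have ip : P.-integrable setT (EFin \o ((f i0)^\+ \o X i0)).
  apply: le_integrable i0f => //.
    by apply/measurable_EFinP; apply: measurableT_comp => //; exact: measurable_funrpos.
  move=> w _; rewrite /= lee_fin [leLHS]ger0_norm ?funrpos_ge0//.
  by rewrite ge_max ler_norm normr_ge0.
have iN : P.-integrable setT (EFin \o ((f i0)^\- \o X i0)).
  apply: le_integrable i0f => //.
    by apply/measurable_EFinP; apply: measurableT_comp => //; exact: measurable_funrneg.
  move=> w _; rewrite /= lee_fin [leLHS]ger0_norm ?funrneg_ge0//.
  by rewrite ge_max ler_normr lexx orbT normr_ge0.
have adp : admissible (f' (f i0)^\+).
  move=> i; rewrite /f'; case: eqP => [->|_]; last exact: adf.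
  by split; [exact: measurable_funrpos|exact: ip].
have adn : admissible (f' (f i0)^\-).
  move=> i; rewrite /f'; case: eqP => [->|_]; last exact: adf.
  by split; [exact: measurable_funrneg|exact: iN].
have eqG g w : \prod_i f' g i (X i w) =
    g (X i0 w) * (\prod_(i | i != i0) f i (X i w)).
  rewrite (bigD1 i0)//= {1}/f' eqxx; congr (_ * _).
  by apply: eq_bigr => i ii0; rewrite /f' (negbTE ii0).
have eqE g : \prod_i \int[P]_w f' g i (X i w) =
    \int[P]_w g (X i0 w) * (\prod_(i | i != i0) \int[P]_w f i (X i w)).
  rewrite (bigD1 i0)//= {1}/f' eqxx; congr (_ * _).
  by apply: eq_bigr => i ii0; rewrite /f' (negbTE ii0).
have fE x : f i0 x = (f i0)^\+ x - (f i0)^\- x.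
  by have /(congr1 (@^~ x)) := funrposBneg (f i0).
transitivity (\int[P]_w (\prod_i f' (f i0)^\+ i (X i w) - \prod_i f' (f i0)^\- i (X i w))).
  apply: eq_Rintegral => w _; rewrite !eqG -mulrBl -fE.
  by rewrite (bigD1 i0).
rewrite RintegralB//; last 2 first.
- exact: integrable_indep_prod.
- exact: integrable_indep_prod.
have pos' g : (forall x, 0 <= g x) -> forall i x, i \notin J -> 0 <= f' g i x.
  move=> g0 i x iJ; rewrite /f'; have [//|ii0] := eqVneq i i0.
  by apply: fpos; rewrite inE negb_or ii0.
rewrite !IH//; last 2 first.
- by apply: pos' => x; exact: funrneg_ge0.
- by apply: pos' => x; exact: funrpos_ge0.
rewrite !eqE -mulrBl -RintegralB//.
rewrite [RHS](bigD1 i0)//=; congr (_ * _).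
by apply: eq_Rintegral => w _; rewrite -fE.
Qed.

Lemma Rintegral_indep_prod f : admissible f ->
  \int[P]_w (\prod_i f i (X i w)) = \prod_i \int[P]_w f i (X i w).
Proof.
move=> adf; apply: (Rintegral_prod_signed (J := index_enum I)) => // i x.
by rewrite mem_index_enum.
Qed.

End IndependentProducts.

(** * Integration by parts for polynomials in independent Gaussian variables *)

Section GaussianIntegrationByParts.
Context d (T : measurableType d) (R : realType) (P : probability T R).
Variables (I : finType) (X : I -> T -> R) (s2 : I -> R).
Hypothesis indX : independent_family P X.
Hypothesis gX : forall i, is_centered_gaussian P (X i) (s2 i).
Implicit Types (s t : seq I) (e : I -> R[i]).

Definition mon s (w : T) : R := \prod_(i <- s) X i w.

Lemma monE s w : mon s w = \prod_i X i w ^+ count_mem i s.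
Proof.
rewrite /mon; elim: s => [|j s IH]; first by rewrite big_nil big1.
rewrite big_cons IH (bigD1 j)//= [RHS](bigD1 j)//= eqxx exprS mulrA.
by congr (_ * _); apply: eq_bigr => i ij; rewrite eq_sym (negbTE ij).
Qed.

Let mX i : measurable_fun setT (X i). Proof. by case: (gX i). Qed.

Let mon_admissible s i : measurable_fun setT (fun x : R => x ^+ count_mem i s) /\
  P.-integrable setT (EFin \o ((fun x : R => x ^+ count_mem i s) \o X i)).
Proof. by split; [exact: measurable_funX|exact: integrable_gaussian_moment (gX i) _]. Qed.

Lemma integrable_mon s : P.-integrable setT (EFin \o mon s).
Proof.
rewrite (_ : mon s = fun w => \prod_i X i w ^+ count_mem i s); last first.
  by apply/funext => w; exact: monE.
exact: (@integrable_indep_prod _ _ _ _ _ _ indX mX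
  (fun i x => x ^+ count_mem i s) (mon_admissible s)).
Qed.

Lemma Rintegral_mon s :
  \int[P]_w mon s w = \prod_i \int[P]_w (X i w ^+ count_mem i s).
Proof.
rewrite (_ : mon s = fun w => \prod_i X i w ^+ count_mem i s); last first.
  by apply/funext => w; exact: monE.
exact: (@Rintegral_indep_prod _ _ _ _ _ _ indX mX
  (fun i x => x ^+ count_mem i s) (mon_admissible s)).
Qed.

(** Independence isolates the power of [X i], and the one-variable recursion lowers its exponent by
    two, which leaves the exponents of [rem i s]. If [i] does not occur in [s], the coefficient is
    0. *)
Lemma Rintegral_mon_cons i s : \int[P]_w mon (i :: s) w =
  s2 i * (count_mem i s)%:R * \int[P]_w mon (rem i s) w.
Proof.
rewrite !Rintegral_mon (bigD1 i)//= eqxx (gaussian_moment_rec (gX i)).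
rewrite [in RHS](bigD1 i)//= [_%:R * s2 i]mulrC -!mulrA; congr (_ * _).
have [is_|is_] := boolP (i \in s); last by rewrite (count_memPn is_) !mul0r.
congr (_ * _).
have cE j : count_mem j (rem i s) = (count_mem j s - (j == i))%N.
  by rewrite (permP (perm_to_rem is_) (pred1 j)) /= [i == j]eq_sym addnC addnK.
rewrite cE eqxx subn1; congr (_ * _).
by apply: eq_bigr => j ji; rewrite cE eq_sym (negbTE ji) subn0.
Qed.

Definition cintegrable (Z : T -> R[i]) :=
  P.-integrable setT (EFin \o (fun w => complex.Re (Z w))) /\
  P.-integrable setT (EFin \o (fun w => complex.Im (Z w))).

Lemma complex_expectationE Z : complex_expectation P Z =
  (\int[P]_w complex.Re (Z w)) +i* (\int[P]_w complex.Im (Z w)).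
Proof. by rewrite /complex_expectation unlock. Qed.

Lemma cintegrable0 : cintegrable (fun=> 0).
Proof. by split; exact: integrable0. Qed.

Lemma complex_expectation0 : complex_expectation P (fun=> 0) = 0.
Proof. by rewrite complex_expectationE /= !Rintegral_cst//= mul0r. Qed.

Lemma cintegrableD Z Z' : cintegrable Z -> cintegrable Z' ->
  cintegrable (fun w => Z w + Z' w).
Proof.
move=> [Zr Zi] [Z'r Z'i]; split.
- rewrite (_ : _ \o _ = (EFin \o (fun w => complex.Re (Z w))) \+
    (EFin \o (fun w => complex.Re (Z' w))))%E; first exact: integrableD.
  by apply/funext => w /=; rewrite raddfD EFinD.
- rewrite (_ : _ \o _ = (EFin \o (fun w => complex.Im (Z w))) \+
    (EFin \o (fun w => complex.Im (Z' w))))%E; first exact: integrableD.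
  by apply/funext => w /=; rewrite raddfD EFinD.
Qed.

Lemma complex_expectationD Z Z' : cintegrable Z -> cintegrable Z' ->
  complex_expectation P (fun w => Z w + Z' w) =
  complex_expectation P Z + complex_expectation P Z'.
Proof.
move=> [Zr Zi] [Z'r Z'i]; rewrite !complex_expectationE.
have -> : (fun w => complex.Re (Z w + Z' w)) = (fun w => complex.Re (Z w) + complex.Re (Z' w)).
  by apply/funext => w; rewrite raddfD.
have -> : (fun w => complex.Im (Z w + Z' w)) = (fun w => complex.Im (Z w) + complex.Im (Z' w)).
  by apply/funext => w; rewrite raddfD.
by rewrite !RintegralD.
Qed.

Lemma cintegrableZ (c : R[i]) Z : cintegrable Z -> cintegrable (fun w => c * Z w).
Proof.
case: c => a b [Zr Zi].
have sc (r : R) (f : T -> R) : P.-integrable setT (EFin \o f) ->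
    P.-integrable setT (EFin \o (fun w => r * f w)).
  move=> fi; rewrite (_ : _ \o _ = (fun w => r%:E * (EFin \o f) w)%E)//.
  exact: integrableZl.
split.
- rewrite (_ : _ \o _ = (EFin \o (fun w => a * complex.Re (Z w))%R) \-
    (EFin \o (fun w => b * complex.Im (Z w))%R))%E; first by apply: integrableB => //; exact: sc.
  by apply/funext => w /=; case: (Z w).
- rewrite (_ : _ \o _ = (EFin \o (fun w => a * complex.Im (Z w))%R) \+
    (EFin \o (fun w => b * complex.Re (Z w))%R))%E; first by apply: integrableD => //; exact: sc.
  by apply/funext => w /=; case: (Z w).
Qed.

Lemma complex_expectationZ (c : R[i]) Z : cintegrable Z ->
  complex_expectation P (fun w => c * Z w) = c * complex_expectation P Z.
Proof.
case: c => a b [Zr Zi]; rewrite !complex_expectationE.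
have sc (r : R) (f : T -> R) : P.-integrable setT (EFin \o f) ->
    P.-integrable setT (EFin \o (fun w => r * f w)).
  move=> fi; rewrite (_ : _ \o _ = (fun w => r%:E * (EFin \o f) w)%E)//.
  exact: integrableZl.
have -> : (fun w => complex.Re ((a +i* b) * Z w)) =
    (fun w => a * complex.Re (Z w) - b * complex.Im (Z w)).
  by apply/funext => w; case: (Z w).
have -> : (fun w => complex.Im ((a +i* b) * Z w)) =
    (fun w => a * complex.Im (Z w) + b * complex.Re (Z w)).
  by apply/funext => w; case: (Z w).
rewrite RintegralB ?RintegralD//; try exact: sc.
by rewrite !RintegralZl.
Qed.

Lemma cintegrable_sum (J : Type) (r : seq J) (Q : pred J) (F : J -> T -> R[i]) :
  (forall j, cintegrable (F j)) -> cintegrable (fun w => \sum_(j <- r | Q j) F j w).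
Proof.
move=> Fi; under eq_fun do rewrite -big_filter.
elim: (seq.filter Q r) => [|j s IH].
  by under eq_fun do rewrite big_nil; exact: cintegrable0.
by under eq_fun do rewrite big_cons; exact: cintegrableD.
Qed.

Lemma complex_expectation_sum (J : Type) (r : seq J) (Q : pred J) (F : J -> T -> R[i]) :
  (forall j, cintegrable (F j)) ->
  complex_expectation P (fun w => \sum_(j <- r | Q j) F j w) =
  \sum_(j <- r | Q j) complex_expectation P (F j).
Proof.
move=> Fi; under eq_fun do rewrite -big_filter.
rewrite -big_filter; elim: (seq.filter Q r) => [|j s IH].
  by under eq_fun do rewrite big_nil; rewrite complex_expectation0 big_nil.
under eq_fun do rewrite big_cons.
rewrite complex_expectationD ?big_cons ?IH//.
exact: (@cintegrable_sum _ s xpredT).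
Qed.

Definition cmon s (w : T) : R[i] := (mon s w)%:C.

Lemma cintegrable_cmon s : cintegrable (cmon s).
Proof. by split; [exact: integrable_mon|exact: integrable0]. Qed.

Lemma complex_expectation_cmon s :
  complex_expectation P (cmon s) = (\int[P]_w mon s w)%:C.
Proof. by rewrite complex_expectationE /= Rintegral_cst//= mul0r. Qed.

Lemma cmon_cons i s w : cmon (i :: s) w = (X i w)%:C * cmon s w.
Proof. by rewrite /cmon /mon big_cons rmorphM. Qed.

Lemma cmon_cat s t w : cmon (s ++ t) w = cmon s w * cmon t w.
Proof. by rewrite /cmon /mon big_cat rmorphM. Qed.

(** Formal derivative of a monomial in the direction giving [X i] the derivative [e i], by the
    Leibniz rule along the list. It is attached to the list, as different lists may define the same
    random variable. *)
Fixpoint dmon e s (w : T) : R[i] :=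
  if s is i :: s' then e i * cmon s' w + (X i w)%:C * dmon e s' w else 0.

Lemma dmon_cat e s t w :
  dmon e (s ++ t) w = dmon e s w * cmon t w + cmon s w * dmon e t w.
Proof.
elim: s => [|i s IH] /=; first by rewrite mul0r add0r /cmon /mon big_nil mul1r.
rewrite IH cmon_cat cmon_cons; ring.
Qed.

(** All occurrences of [i] contribute the same monomial because the variables commute; this is the
    shape produced by [Rintegral_mon_cons]. *)
Lemma dmonE e s w :
  dmon e s w = \sum_i e i * (count_mem i s)%:R * cmon (rem i s) w.
Proof.
elim: s => [|j s IH] /=; first by rewrite big1// => i _; rewrite mulr0 mul0r.
rewrite IH mulr_sumr (bigD1 j)//= [RHS](bigD1 j)//= eqxx add1n.
have -> : (X j w)%:C * (e j * (count_mem j s)%:R * cmon (rem j s) w) =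
    e j * (count_mem j s)%:R * cmon s w.
  have [js|js] := boolP (j \in s); last by rewrite (count_memPn js) mulr0 !mul0r mulr0.
  rewrite mulrCA -cmon_cons; congr (_ * _).
  by congr (_%:C); apply: perm_big; rewrite perm_sym; exact: perm_to_rem.
rewrite addrA; congr (_ + _); first by rewrite -natr1; ring.
apply: eq_bigr => i ij; rewrite eq_sym (negbTE ij) add0n.
by rewrite cmon_cons; ring.
Qed.

(* [wick_deriv e f f'] : [f] is a polynomial in the [X i] and [f'] its
   derivative in the direction [e]. *)
Definition wick_deriv e (f f' : T -> R[i]) := exists p : seq (R[i] * seq I),
  f = (fun w => \sum_(m <- p) m.1 * cmon m.2 w) /\
  f' = (fun w => \sum_(m <- p) m.1 * dmon e m.2 w).

Lemma wick_deriv_cst e c : wick_deriv e (fun=> c) (fun=> 0).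
Proof.
exists [:: (c, [::])]; split; apply/funext => w; rewrite big_seq1 /= ?mulr0//.
by rewrite /cmon /mon big_nil mulr1.
Qed.

Lemma wick_deriv_var e i : wick_deriv e (fun w => (X i w)%:C) (fun=> e i).
Proof.
exists [:: (1, [:: i])]; split; apply/funext => w; rewrite big_seq1 /= mul1r.
  by rewrite cmon_cons /cmon /mon big_nil mulr1.
by rewrite /cmon /mon big_nil mulr1 mulr0 addr0.
Qed.

Lemma wick_derivD e f f' g g' : wick_deriv e f f' -> wick_deriv e g g' ->
  wick_deriv e (fun w => f w + g w) (fun w => f' w + g' w).
Proof.
move=> [p [-> ->]] [q [-> ->]]; exists (p ++ q).
by split; apply/funext => w; rewrite big_cat.
Qed.

Lemma wick_derivM e f f' g g' : wick_deriv e f f' -> wick_deriv e g g' ->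
  wick_deriv e (fun w => f w * g w) (fun w => f' w * g w + f w * g' w).
Proof.
move=> [p [-> ->]] [q [-> ->]].
exists [seq (m.1 * m'.1, m.2 ++ m'.2) | m <- p, m' <- q].
split; apply/funext => w; rewrite big_allpairs_dep /=.
  rewrite mulr_suml; apply: eq_bigr => m _; rewrite mulr_sumr.
  by apply: eq_bigr => m' _; rewrite cmon_cat; ring.
rewrite !mulr_suml -big_split /=; apply: eq_bigr => m _.
rewrite !mulr_sumr -big_split /=; apply: eq_bigr => m' _.
by rewrite dmon_cat; ring.
Qed.

Lemma wick_deriv_sum e (J : Type) (r : seq J) (Q : pred J) (F F' : J -> T -> R[i]) :
  (forall j, wick_deriv e (F j) (F' j)) ->
  wick_deriv e (fun w => \sum_(j <- r | Q j) F j w) (fun w => \sum_(j <- r | Q j) F' j w).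
Proof.
move=> FF'.
have E (G : J -> T -> R[i]) : (fun w => \sum_(j <- r | Q j) G j w) =
    (fun w => \sum_(j <- seq.filter Q r) G j w) by under [RHS]eq_fun do rewrite big_filter.
rewrite !E; elim: (seq.filter Q r) => [|j s IH].
  have E0 (G : J -> T -> R[i]) : (fun w => \sum_(j <- [::]) G j w) = (fun=> 0).
    by apply/funext => w; rewrite big_nil.
  by rewrite !E0; exact: wick_deriv_cst.
have Ec (G : J -> T -> R[i]) : (fun w => \sum_(j <- j :: s) G j w) =
    (fun w => G j w + \sum_(j <- s) G j w).
  by apply/funext => w; rewrite big_cons.
by rewrite !Ec; exact: wick_derivD.
Qed.

Lemma wick_derivZ e c f f' : wick_deriv e f f' ->
  wick_deriv e (fun w => c * f w) (fun w => c * f' w).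
Proof.
move=> ff'; have := wick_derivM (wick_deriv_cst e c) ff'.
by under [X in wick_deriv _ _ X]eq_fun do rewrite mul0r add0r.
Qed.

Lemma cintegrable_wick e f f' : wick_deriv e f f' -> cintegrable f.
Proof.
move=> [p [-> _]]; apply: cintegrable_sum => m.
exact/cintegrableZ/cintegrable_cmon.
Qed.

(** By linearity this reduces to one variable and one monomial. The direction multiplies the
    coefficients of the linear form by the variances since the covariance matrix of the family is
    diagonal. *)
Lemma gaussian_ibp (c : I -> R[i]) f f' :
  wick_deriv (fun i => c i * (s2 i)%:C) f f' ->
  complex_expectation P (fun w => (\sum_i c i * (X i w)%:C) * f w) =
  complex_expectation P f'.
Proof.
move=> [p [-> ->]].
under eq_fun do rewrite mulr_sumr.
have Xm (m : R[i] * seq I) : (fun w => (\sum_i c i * (X i w)%:C) * (m.1 * cmon m.2 w)) =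
    (fun w => \sum_i (m.1 * c i) * cmon (i :: m.2) w).
  apply/funext => w; rewrite mulr_suml; apply: eq_bigr => i _.
  by rewrite cmon_cons; ring.
have Dm (m : R[i] * seq I) : (fun w => m.1 * dmon (fun i => c i * (s2 i)%:C) m.2 w) =
    (fun w => \sum_i (m.1 * c i * (s2 i)%:C * (count_mem i m.2)%:R) * cmon (rem i m.2) w).
  apply/funext => w; rewrite dmonE mulr_sumr; apply: eq_bigr => i _; ring.
have intZ k s : cintegrable (fun w => k * cmon s w).
  exact/cintegrableZ/cintegrable_cmon.
rewrite complex_expectation_sum; last first.
  by move=> m; rewrite Xm; exact: cintegrable_sum.
rewrite complex_expectation_sum; last first.
  by move=> m; rewrite Dm; exact: cintegrable_sum.
apply: eq_bigr => m _; rewrite Xm Dm !complex_expectation_sum//.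
apply: eq_bigr => i _; rewrite !complex_expectationZ; try exact: cintegrable_cmon.
rewrite !complex_expectation_cmon Rintegral_mon_cons !rmorphM/= rmorph_nat; ring.
Qed.

End GaussianIntegrationByParts.

(** * Loop equation for traces of words *)

Section Letters.
Variable p : nat.

(* The letter (j, false) stands for j + 1 and (j, true) for (j + 1)^*; a word
   is read as a walk on the blocks in which j + 1 goes from block j to j + 1. *)
Notation letter_type := ('I_p * bool)%type.
Implicit Types (x : letter_type) (u s : seq letter_type) (q r : 'I_p.+1).

Definition src x : 'I_p.+1 := if x.2 then lift ord0 x.1 else widen_ord (leqnSn p) x.1.
Definition tgt x : 'I_p.+1 := if x.2 then widen_ord (leqnSn p) x.1 else lift ord0 x.1.
Definition adj x : letter_type := (x.1, ~~ x.2).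

Lemma src_adj x : src (adj x) = tgt x. Proof. by case: x => j []. Qed.
Lemma tgt_adj x : tgt (adj x) = src x. Proof. by case: x => j []. Qed.

Fixpoint walk q u r : bool :=
  if u is x :: u' then (src x == q) && walk (tgt x) u' r else q == r.

Lemma walk_cat q u s r : walk q (u ++ s) r = [exists q', walk q u q' && walk q' s r].
Proof.
apply/idP/existsP => [|[q' /andP[]]]; elim: u q => [|x u IH] q //=.
- by move=> h; exists q; rewrite eqxx.
- by move=> /andP[-> /IH[q' h]]; exists q'.
- by move=> /eqP ->.
- by move=> /andP[-> /IH h] /h.
Qed.

Lemma walk_split q x0 (t : nat) u r : (t < size u)%N -> walk q u r ->
  walk q (take t u) (src (nth x0 u t)) /\ walk (tgt (nth x0 u t)) (drop t.+1 u) r.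
Proof.
elim: u q t => [|x u IH] q [|t] //= tu /andP[/eqP <- h]; first by rewrite drop0 eqxx.
by have [h1 h2] := IH _ _ tu h; rewrite h1 eqxx.
Qed.

End Letters.

Lemma sum_pair_bool (V : nmodType) (I : finType) (F : I * bool -> V) (i : I) :
  (forall c, c.1 != i -> F c = 0) -> \sum_c F c = F (i, false) + F (i, true).
Proof.
move=> F0; rewrite (bigD1 (i, false))//= (bigD1 (i, true)) ?xpair_eqE ?andbF//=.
rewrite big1 ?addr0// => -[j b] /andP[]; rewrite !xpair_eqE => h1 h2.
by apply: F0 => /=; case: b h1 h2 => /=; rewrite ?andbT ?andbF.
Qed.

Section LoopEquation.
Variables (R : realType) (p n : nat) (N : 'I_p.+1 -> {set 'I_n}).
Notation letter_type := ('I_p * bool)%type.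
Notation word_type := (seq letter_type).
Implicit Types (x y : letter_type) (u s : word_type) (q r : 'I_p.+1).
Implicit Types (A : 'M[R[i]]_n) (ws : seq ('I_p.+1 * word_type)).

Definition letter_entry A x (a b : 'I_n) : R[i] :=
  if x.2 then Num.conj (A b a) else A a b.

Definition letter_mx A x : 'M[R[i]]_n :=
  \matrix_(a, b) (((a \in N (src x)) && (b \in N (tgt x)))%:R * letter_entry A x a b).

Definition word_mx A u : 'M[R[i]]_n := foldr (fun x M => letter_mx A x *m M) 1%:M u.

Definition block_trace A q u : R[i] := \sum_(a in N q) word_mx A u a a.

Definition tau A q u : R[i] := #|N q|%:R^-1 * block_trace A q u.

Definition tau_prod A ws : R[i] := \prod_(k <- ws) tau A k.1 k.2.

Lemma word_mx_cat A u s : word_mx A (u ++ s) = word_mx A u *m word_mx A s.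
Proof. by elim: u => [|x u IH] /=; rewrite ?mul1mx// IH mulmxA. Qed.

Lemma word_mx_walk A q u r (a b : 'I_n) : walk q u r -> a \in N q -> b \notin N r ->
  word_mx A u a b = 0.
Proof.
elim: u q a => [|x u IH] q a /=.
  move=> /eqP <- aq br; rewrite !mxE; case: eqP => // ab.
  by rewrite -ab aq in br.
move=> /andP[_ h] aq br; rewrite mxE big1// => c _.
have [cx|cx] := boolP (c \in N (tgt x)); first by rewrite (IH _ _ h)// mulr0.
by rewrite !mxE (negbTE cx) andbF !mul0r.
Qed.

Lemma sum_word_mx_walk A q u r s (a b : 'I_n) : walk q u r -> a \in N q ->
  word_mx A (u ++ s) a b = \sum_(c in N r) word_mx A u a c * word_mx A s c b.
Proof.
move=> h aq; rewrite word_mx_cat mxE [RHS]big_mkcond; apply: eq_bigr => c _.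
by case: ifPn => // cr; rewrite (word_mx_walk A h aq cr) mul0r.
Qed.

(** Contracting the letter [x] of the trace of [x :: s] with the letter [adj x] of a trace reading
    [y], [adj x], [z] from block [r] identifies their end indices. After a cyclic rotation of the
    second trace, what remains is one closed walk based at [src x]. *)
Lemma block_trace_merge A x (z y : word_type) s r :
  walk (src x) z r -> walk r y (tgt x) -> walk (tgt x) s (src x) ->
  \sum_(a in N (src x)) \sum_(b in N (tgt x)) \sum_(c in N r)
     word_mx A s b a * (word_mx A y c b * word_mx A z a c) =
  block_trace A (src x) (z ++ y ++ s).
Proof.
move=> hz hy hs; apply: eq_bigr => a ax.
rewrite (sum_word_mx_walk A _ _ hz ax) exchange_big/=; apply: eq_bigr => c cr.
rewrite (sum_word_mx_walk A _ _ hy cr) mulr_sumr; apply: eq_bigr => b _; ring.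
Qed.

Context d (T : measurableType d) (P : probability T R) (Y : T -> 'M[R[i]]_n).
Variable v : 'M[R]_p.+1.
Hypothesis hN : interval_partition N.
Hypothesis hv1 : forall j : 'I_p, v (widen_ord (leqnSn p) j) (lift ord0 j) = 1.
Hypothesis hY : gaussian_block_matrix P N v Y.

Let disjN q r (a : 'I_n) : a \in N q -> a \in N r -> q = r.
Proof.
move=> aq ar; apply/eqP/negPn/negP => qr; have [_ h _ _] := hN.
by have /setP/(_ a) := h _ _ qr; rewrite !inE aq ar.
Qed.

(** Integration by parts takes a variance for each index, so the blocks of row and column are looked
    up here; the blocks cover all indices, hence the default 0 is never met. *)
Let s2 (c : 'I_n * 'I_n * bool) : R :=
  let blk a := [pick q | a \in N q] in
  if blk c.1.1 is Some q then if blk c.1.2 is Some r then v q r / (2 * n)%:R else 0 else 0.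

Let s2E q r a b c : a \in N q -> b \in N r -> s2 (a, b, c) = v q r / (2 * n)%:R.
Proof.
move=> aq br; rewrite /s2 /=.
case: pickP => [q' aq'|/(_ q)]; last by rewrite aq.
case: pickP => [r' br'|/(_ r)]; last by rewrite br.
by rewrite (disjN aq aq') (disjN br br').
Qed.

Let gY c : is_centered_gaussian P (entry_part Y c) (s2 c).
Proof.
case: c => -[a b] c; have [_ _ cover _] := hN.
have [q aq] := cover a; have [r br] := cover b.
by rewrite (s2E c aq br); exact: hY.2.
Qed.

Let wd := @wick_deriv _ T R _ (entry_part Y).

(* Coordinates of the entry (a, b) of the letter x in the real Gaussian family. *)
Let dir x a b (c : 'I_n * 'I_n * bool) : R[i] :=
  (c.1 == if x.2 then (b, a) else (a, b))%:R *
  (if c.2 then if x.2 then - 'i%C else 'i%C else 1).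

(** The direction that [gaussian_ibp] attaches to the linear form with coefficients [dir x a b]. *)
Let cdir x a b c := dir x a b c * (s2 c)%:C.

Let letter_entryE x a b w :
  letter_entry (Y w) x a b = \sum_c dir x a b c * (entry_part Y c w)%:C.
Proof.
set pos := if x.2 then (b, a) else (a, b).
rewrite (@sum_pair_bool _ _ _ pos); last first.
  by move=> c cp; rewrite /dir (negbTE cp) !mul0r.
rewrite /dir /= eqxx !mul1r /entry_part /letter_entry /pos.
case: x @pos => j [] /=; last by rewrite [LHS]complexE.
case: (Y w b a) => f g; apply/eqP; rewrite eq_complex /=.
by apply/andP; split; apply/eqP; ring.
Qed.

(** This is the covariance, without conjugation, of two letter entries. Real and imaginary parts
    contribute [1 + i^2 = 0] when both letters or neither are starred, and [1 - i^2 = 2] when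
    exactly one is, whence [s *+ 2]. *)
Let dir_pairing x y a b a' b' (s : R) :
  (forall c, s2 ((if x.2 then (b, a) else (a, b)), c) = s) ->
  \sum_c dir y a' b' c * cdir x a b c =
  [&& x.2 != y.2, a' == b & b' == a]%:R * (s *+ 2)%:C.
Proof.
rewrite /cdir /dir; set pos := if x.2 then (b, a) else (a, b) => sE.
rewrite (@sum_pair_bool _ _ _ pos); last first.
  by move=> c cp; rewrite (negbTE cp) !mul0r mulr0.
rewrite !sE eqxx !mul1r rmorphMn/=.
have ii : 'i%C * 'i%C = -1 :> R[i] by rewrite -expr2 sqr_i.
have h0 (k z : R[i]) : k * 1 * z + k * 'i%C * ('i%C * z) = 0.
  by transitivity (k * z * (1 + 'i%C * 'i%C)); [ring|rewrite ii subrr mulr0].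
have h2 (k z : R[i]) : k * 1 * z - k * 'i%C * ('i%C * z) = k * (z *+ 2).
  transitivity (k * z * (1 - 'i%C * 'i%C)); first ring.
  by rewrite ii -mulrA opprK -mulr2n mulr_natr.
rewrite /pos; case: x {pos sE} => j []; case: y => j' [] /=;
  rewrite ?xpair_eqE ?mul0r ?[(b == b') && _]andbC ?[b == _]eq_sym ?[a == _]eq_sym.
- by rewrite mulrN !mulNr mulrN opprK.
- by rewrite mulNr mulrN.
- by rewrite mulrN mulNr andbC.
- by [].
Qed.

(** The factor [n^-1] is twice the variance [1 / (2 n)]. The covariance forces opposite stars and
    transposed indices; then [a' = b] lies in both [N (tgt x)] and [N (src y)], and disjointness of
    the blocks leaves only [y = adj x]. *)
Let wick_letter x y a b a' b' :
  a \in N (src x) -> b \in N (tgt x) ->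
  wd (cdir x a b) (fun w => letter_mx (Y w) y a' b')
    (fun=> [&& y == adj x, a' == b & b' == a]%:R * n%:R^-1).
Proof.
move=> ax bx.
pose ind : R[i] := ((a' \in N (src y)) && (b' \in N (tgt y)))%:R.
suff <- : ind * \sum_c dir y a' b' c * cdir x a b c =
    [&& y == adj x, a' == b & b' == a]%:R * n%:R^-1.
  rewrite (_ : (fun w => letter_mx (Y w) y a' b') =
    (fun w => ind * \sum_c dir y a' b' c * (entry_part Y c w)%:C)); last first.
    by apply/funext => w; rewrite mxE letter_entryE.
  apply: wick_derivZ; apply: wick_deriv_sum => c; apply: wick_derivZ.
  exact: wick_deriv_var.
pose s : R := (2 * n)%:R^-1.
have sE c : s2 ((if x.2 then (b, a) else (a, b)), c) = s.
  rewrite /s -[_^-1]mul1r; case: x ax bx => j [] /= ax bx.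
    by rewrite (s2E c bx ax) hv1.
  by rewrite (s2E c ax bx) hv1.
rewrite (dir_pairing _ _ _ sE).
have sn : (s *+ 2)%:C = n%:R^-1 :> R[i].
  rewrite /s -[_ *+ 2]mulr_natr natrM invfM mulrAC mulVf ?mul1r ?pnatr_eq0//.
  by rewrite fmorphV rmorph_nat.
rewrite sn mulrA -natrM mulnb; congr ((nat_of_bool _)%:R * _).
apply/idP/idP => [/andP[/andP[a'y b'y] /and3P[xy /eqP a'b /eqP b'a]]|
                  /and3P[/eqP -> /eqP -> /eqP ->]]; last first.
  by rewrite src_adj tgt_adj ax bx !eqxx /adj/=; case: (x.2).
rewrite a'b b'a !eqxx !andbT.
have := disjN bx; rewrite a'b in a'y => /(_ _ a'y).
case: x y {ind ax bx a'y b'y sE} xy => [j []] [j' []] //= _ h.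
  by apply/eqP; congr (_, _); apply/val_inj; have := congr1 val h; rewrite /= => ->.
apply/eqP; congr (_, _); apply/val_inj; have := congr1 val h.
by rewrite /= /bump /= !add1n => -[->].
Qed.

(** Leibniz rule: differentiating the occurrence of [adj x] at position [t] cuts the word there and
    pins the two loose ends at [b] and [a]. *)
Let wick_word x u a b a' b' : a \in N (src x) -> b \in N (tgt x) ->
  wd (cdir x a b) (fun w => word_mx (Y w) u a' b')
    (fun w => \sum_(t < size u | nth x u t == adj x) n%:R^-1 *
       (word_mx (Y w) (take t u) a' b * word_mx (Y w) (drop t.+1 u) a b')).
Proof.
move=> ax bx; elim: u a' => [|y u IH] a'.
  rewrite (_ : (fun w => \sum_(_ < _ | _) _) = fun=> 0); last first.
    by apply/funext => w; rewrite big_ord0.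
  exact: wick_deriv_cst.
rewrite (_ : (fun w => word_mx _ (y :: u) _ _) =
  (fun w => \sum_c letter_mx (Y w) y a' c * word_mx (Y w) u c b')); last first.
  by apply/funext => w; rewrite mxE.
have := wick_deriv_sum (index_enum _) xpredT
  (fun c => wick_derivM (wick_letter y a' c ax bx) (IH c)).
congr (wick_deriv _ _ _); apply/funext => w.
rewrite big_split/= [RHS]big_mkcond/= [RHS]big_ord_recl /= drop0.
congr (_ + _).
  rewrite (bigD1 a)//= big1 ?addr0; last first.
    by move=> c ca; rewrite (negbTE ca) !andbF !mul0r.
  rewrite eqxx andbT !mxE; case: eqP => _ /=; last by rewrite !mul0r.
  by rewrite [RHS]mulrCA mulrA.
under eq_bigr do rewrite mulr_sumr.
rewrite exchange_big/= [LHS]big_mkcond; apply: eq_bigr => t _ /=.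
case: ifP => _ //; rewrite mxE mulr_suml mulr_sumr.
by apply: eq_bigr => c _; ring.
Qed.

Let wick_trace x q u a b : a \in N (src x) -> b \in N (tgt x) ->
  wd (cdir x a b) (fun w => tau (Y w) q u)
    (fun w => \sum_(t < size u | nth x u t == adj x) (n%:R^-1 * #|N q|%:R^-1) *
       \sum_(c in N q)
       (word_mx (Y w) (take t u) c b * word_mx (Y w) (drop t.+1 u) a c)).
Proof.
move=> ax bx.
have := wick_derivZ (#|N q|%:R^-1) (wick_deriv_sum (index_enum _) (mem (N q))
  (fun c => wick_word u c c ax bx)).
congr (wick_deriv _ _ _); apply/funext => w.
rewrite exchange_big/= mulr_sumr; apply: eq_bigr => t _.
by rewrite -mulr_sumr mulrA [n%:R^-1 * _]mulrC.
Qed.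

Let wick_tau_prod x (ws : seq ('I_p.+1 * word_type)) a b :
  a \in N (src x) -> b \in N (tgt x) ->
  wd (cdir x a b) (fun w => tau_prod (Y w) ws)
    (fun w => \sum_(k < size ws)
       let c := nth (src x, [::]) ws k in
       (\sum_(t < size c.2 | nth x c.2 t == adj x) (n%:R^-1 * #|N c.1|%:R^-1) *
       \sum_(e in N c.1)
       (word_mx (Y w) (take t c.2) e b * word_mx (Y w) (drop t.+1 c.2) a e)) *
       tau_prod (Y w) (take k ws ++ drop k.+1 ws)).
Proof.
move=> ax bx; elim: ws => [|k ws IH].
  rewrite (_ : (fun w => tau_prod _ _) = fun=> 1); last first.
    by apply/funext => w; rewrite /tau_prod big_nil.
  rewrite (_ : (fun w => \sum_(_ < _) _) = fun=> 0); first exact: wick_deriv_cst.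
  by apply/funext => w; rewrite big_ord0.
rewrite (_ : (fun w => tau_prod _ _) =
   (fun w => tau (Y w) k.1 k.2 * tau_prod (Y w) ws)); last first.
  by apply/funext => w; rewrite /tau_prod big_cons.
have := wick_derivM (wick_trace k.1 k.2 ax bx) IH.
congr (wick_deriv _ _ _); apply/funext => w.
rewrite big_ord_recl /= drop0; congr (_ + _).
rewrite mulr_sumr; apply: eq_bigr => j _ /=.
by rewrite mulrCA {2}/tau_prod big_cons.
Qed.

(** Having a derivative certifies a polynomial in the Gaussian family, and thereby integrability;
    the zero direction is an arbitrary choice. *)
Let poly (f : T -> R[i]) := exists f', wd (fun=> 0) f f'.

Let poly_sum (J : Type) (r : seq J) (Q : pred J) (F : J -> T -> R[i]) :
  (forall j, poly (F j)) -> poly (fun w => \sum_(j <- r | Q j) F j w).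
Proof.
move=> /choice[F' FF']; exists (fun w => \sum_(j <- r | Q j) F' j w).
exact: wick_deriv_sum.
Qed.

Let polyM f g : poly f -> poly g -> poly (fun w => f w * g w).
Proof. by move=> [f' ff'] [g' gg']; eexists; exact: wick_derivM ff' gg'. Qed.

Let polyZ c f : poly f -> poly (fun w => c * f w).
Proof. by move=> [f' ff']; eexists; exact: wick_derivZ ff'. Qed.

Let poly_letter_entry x a b : poly (fun w => letter_entry (Y w) x a b).
Proof.
rewrite (funext (letter_entryE x a b)); apply: poly_sum => c; apply: polyZ.
by eexists; exact: wick_deriv_var.
Qed.

Let poly_word_mx u a b : poly (fun w => word_mx (Y w) u a b).
Proof.
elim: u a => [|x u IH] a; first by eexists; exact: wick_deriv_cst.
rewrite (_ : (fun w => _) =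
  (fun w => \sum_c letter_mx (Y w) x a c * word_mx (Y w) u c b)); last first.
  by apply/funext => w; rewrite mxE.
apply: poly_sum => c; apply: polyM => //.
rewrite (_ : (fun w => _) = fun w =>
  ((a \in N (src x)) && (c \in N (tgt x)))%:R * letter_entry (Y w) x a c).
  exact: polyZ.
by apply/funext => w; rewrite mxE.
Qed.

Let poly_tau_prod ws : poly (fun w => tau_prod (Y w) ws).
Proof.
elim: ws => [|k ws IH].
  rewrite (_ : (fun w => _) = fun=> 1); first by eexists; exact: wick_deriv_cst.
  by apply/funext => w; rewrite /tau_prod big_nil.
rewrite (_ : (fun w => _) = fun w => tau (Y w) k.1 k.2 * tau_prod (Y w) ws).
  by apply: polyM => //; apply: polyZ; exact: poly_sum.
by apply/funext => w; rewrite /tau_prod big_cons.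
Qed.

Let cintegrable_poly f : poly f -> cintegrable P f.
Proof. by move=> [f' ff']; exact: (cintegrable_wick hY.1 gY ff'). Qed.

Lemma cintegrable_block_trace q u : cintegrable P (fun w => block_trace (Y w) q u).
Proof. by apply: cintegrable_poly; exact: poly_sum. Qed.

(* The first letter x of the first trace is contracted with an adjoint letter,
   either in the same trace, which splits in two, or in another one, into which
   it is merged; in the second case the factor 1 / (n * #|N c.1|) makes the term
   negligible. *)
Theorem loop_equation x s ws :
  walk (tgt x) s (src x) -> all (fun c => walk c.1 c.2 c.1) ws ->
  complex_expectation P (fun w => tau_prod (Y w) ((src x, x :: s) :: ws)) =
  \sum_(t < size s | nth x s t == adj x) (#|N (tgt x)|%:R / n%:R) *
    complex_expectation P (fun w =>
      tau_prod (Y w) [:: (tgt x, take t s), (src x, drop t.+1 s) & ws]) +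
  \sum_(k < size ws) let c := nth (src x, [::]) ws k in
    \sum_(t < size c.2 | nth x c.2 t == adj x) (n%:R^-1 / #|N c.1|%:R) *
    complex_expectation P (fun w =>
      tau_prod (Y w) ((src x, drop t.+1 c.2 ++ take t c.2 ++ s) ::
                      take k ws ++ drop k.+1 ws)).
Proof.
move=> hs hws; set q := src x; set q' := tgt x.
have N0 r : #|N r|%:R != 0 :> R[i].
  by rewrite pnatr_eq0 cards_eq0; have [h _ _ _] := hN; exact: h.
(* The first letter is isolated as a linear form in the Gaussians; the rest is the polynomial to be
   differentiated. *)
have tauS w : tau_prod (Y w) ((q, x :: s) :: ws) =
    \sum_(a in N q) \sum_(b in N q') #|N q|%:R^-1 *
      (letter_entry (Y w) x a b * (word_mx (Y w) s b a * tau_prod (Y w) ws)).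
  rewrite {1}/tau_prod big_cons -/(tau_prod _ ws) /tau /block_trace /=.
  rewrite mulr_sumr mulr_suml; apply: eq_bigr => a aq.
  rewrite mxE mulr_sumr mulr_suml [RHS]big_mkcond; apply: eq_bigr => b _.
  rewrite mxE aq /= -/q'; case: ifP => _; first by rewrite mul1r; ring.
  by rewrite !mul0r mulr0 mul0r.
rewrite (funext tauS).
have polyS a b : poly (fun w => #|N q|%:R^-1 *
      (letter_entry (Y w) x a b * (word_mx (Y w) s b a * tau_prod (Y w) ws))).
  by apply/polyZ/polyM => //; exact: polyM.
rewrite complex_expectation_sum; last first.
  by move=> a; apply: cintegrable_poly; exact: poly_sum.
pose D1 a b w := \sum_(t < size s | nth x s t == adj x) n%:R^-1 *
       (word_mx (Y w) (take t s) b b * word_mx (Y w) (drop t.+1 s) a a).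
pose D2 a b w := \sum_(k < size ws)
       let c := nth (src x, [::]) ws k in
       (\sum_(t < size c.2 | nth x c.2 t == adj x) (n%:R^-1 * #|N c.1|%:R^-1) *
       \sum_(e in N c.1)
       (word_mx (Y w) (take t c.2) e b * word_mx (Y w) (drop t.+1 c.2) a e)) *
       tau_prod (Y w) (take k ws ++ drop k.+1 ws).
pose D a b w := D1 a b w * tau_prod (Y w) ws + word_mx (Y w) s b a * D2 a b w.
have wD a b : a \in N q -> b \in N q' ->
    wd (cdir x a b) (fun w => word_mx (Y w) s b a * tau_prod (Y w) ws) (D a b).
  by move=> aq bq'; exact: wick_derivM (wick_word s b a aq bq') (wick_tau_prod ws aq bq').
have poly1 a b : poly (D1 a b) by apply: poly_sum => t; apply/polyZ/polyM.
have poly2 a b : poly (D2 a b).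
  by apply: poly_sum => k; apply: polyM => //; apply: poly_sum => t; apply: polyZ;
    apply: poly_sum => e; exact: polyM.
have polyD a b : poly (D a b).
  have [f' ff'] := polyM (poly1 a b) (poly_tau_prod ws).
  have [g' gg'] := polyM (poly_word_mx s b a) (poly2 a b).
  by eexists; exact: wick_derivD ff' gg'.
transitivity (complex_expectation P (fun w =>
    \sum_(a in N q) \sum_(b in N q') #|N q|%:R^-1 * D a b w)).
  rewrite complex_expectation_sum; last first.
    by move=> a; apply: cintegrable_poly; apply: poly_sum => b; exact: polyZ.
  apply: eq_bigr => a aq; rewrite complex_expectation_sum; last first.
    by move=> b; exact: cintegrable_poly.
  rewrite complex_expectation_sum; last first.
    by move=> b; apply: cintegrable_poly; exact: polyZ.
  apply: eq_bigr => b bq'.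
  rewrite !complex_expectationZ; try apply: cintegrable_poly => //.
    congr (_ * _).
    rewrite -(gaussian_ibp hY.1 gY (wD a b aq bq')).
    by congr complex_expectation; apply/funext => w; rewrite letter_entryE.
  by apply: polyM => //; exact: polyM.
transitivity (complex_expectation P (fun w =>
  \sum_(t < size s | nth x s t == adj x) (#|N q'|%:R / n%:R) *
      tau_prod (Y w) [:: (q', take t s), (q, drop t.+1 s) & ws] +
  \sum_(k < size ws) let c := nth (q, [::]) ws k in
    \sum_(t < size c.2 | nth x c.2 t == adj x) (n%:R^-1 / #|N c.1|%:R) *
      tau_prod (Y w) ((q, drop t.+1 c.2 ++ take t c.2 ++ s) ::
                      take k ws ++ drop k.+1 ws))); last first.
  rewrite complex_expectationD; last 2 first.
  - by apply: cintegrable_poly; apply: poly_sum => t; exact: polyZ.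
  - by apply: cintegrable_poly; apply: poly_sum => k; apply: poly_sum => t; exact: polyZ.
  congr (_ + _).
    rewrite complex_expectation_sum; last first.
      by move=> t; apply: cintegrable_poly; exact: polyZ.
    apply: eq_bigr => t _; rewrite complex_expectationZ//.
    exact: cintegrable_poly.
  rewrite complex_expectation_sum; last first.
    by move=> k; apply: cintegrable_poly; apply: poly_sum => t; exact: polyZ.
  apply: eq_bigr => k _ /=; rewrite complex_expectation_sum; last first.
    by move=> t; apply: cintegrable_poly; exact: polyZ.
  apply: eq_bigr => t _; rewrite complex_expectationZ//.
  exact: cintegrable_poly.
congr complex_expectation; apply/funext => w.
rewrite /D; under eq_bigr do (under eq_bigr do rewrite mulrDr; rewrite big_split/=).
rewrite big_split/=; congr (_ + _).
  rewrite /D1.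
  under eq_bigr do (under eq_bigr do rewrite mulr_suml mulr_sumr; rewrite exchange_big/=).
  rewrite exchange_big/=; apply: eq_bigr => t _.
  rewrite /tau_prod !big_cons -/(tau_prod _ ws) /tau /= /block_trace.
  set St := \sum_(a in N q') _; set Sd := \sum_(a in N q) word_mx _ _ _ _.
  (* The trace over [N q'] arises unnormalized; normalizing it costs a factor [#|N q'|], which
     together with [n^-1] is the ratio in the statement. *)
  transitivity (#|N q|%:R^-1 * n%:R^-1 * tau_prod (Y w) ws * (Sd * St)).
    rewrite /Sd mulr_suml mulr_sumr; apply: eq_bigr => a _.
    rewrite /St !mulr_sumr; apply: eq_bigr => b _; ring.
  by rewrite -!mulrA [#|N q'|%:R * _]mulrCA [#|N q'|%:R * _]mulrA mulfV// mul1r; ring.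
have E2 a b : #|N q|%:R^-1 * (word_mx (Y w) s b a * D2 a b w) =
    \sum_(k < size ws) let c := nth (q, [::]) ws k in
    \sum_(t < size c.2 | nth x c.2 t == adj x) #|N q|%:R^-1 * (word_mx (Y w) s b a *
    ((n%:R^-1 * #|N c.1|%:R^-1) * (\sum_(e in N c.1)
       (word_mx (Y w) (take t c.2) e b * word_mx (Y w) (drop t.+1 c.2) a e)) *
       tau_prod (Y w) (take k ws ++ drop k.+1 ws))).
  rewrite /D2 !mulr_sumr; apply: eq_bigr => k _ /=.
  by rewrite mulr_suml !mulr_sumr.
under eq_bigr do (under eq_bigr do rewrite E2; rewrite exchange_big/=).
rewrite exchange_big/=; apply: eq_bigr => k _.
under eq_bigr do rewrite exchange_big/=.
rewrite exchange_big/=; set c := nth _ _ _; apply: eq_bigr => t xt.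
have /= hc : walk c.1 c.2 c.1 by apply: (all_nthP _ hws) => //.
have [] := walk_split x (ltn_ord t) hc.
rewrite (eqP xt) src_adj tgt_adj => hy hz.
rewrite /tau_prod big_cons -/(tau_prod _ (take k ws ++ drop k.+1 ws)) /tau /=.
(* Two normalized traces become one: [#|N q|^-1] normalizes the merged trace, so [#|N c.1|^-1] is
   left over in the coefficient. *)
rewrite -(block_trace_merge (Y w) hz hy hs).
rewrite -/q -/q' mulr_sumr mulr_suml mulr_sumr; apply: eq_bigr => a _.
rewrite mulr_sumr mulr_suml mulr_sumr; apply: eq_bigr => b _.
rewrite -mulr_sumr; ring.
Qed.

End LoopEquation.

(** * Limits of traces *)

Section ComplexSequences.
Variable R : realType.
Implicit Types (f g : nat -> R[i]) (a b : R[i]).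

Definition ctends f a := (f : nat -> R[i]^o) @ \oo --> (a : R[i]^o).

Lemma ctends_cst a : ctends (fun=> a) a.
Proof. exact: (@cvg_cst R[i]^o). Qed.

Lemma ctendsD f g a b : ctends f a -> ctends g b -> ctends (fun n => f n + g n) (a + b).
Proof. by move=> fa gb; exact: (@cvgD R[i] R[i]^o _ _ _ f g a b fa gb). Qed.

Lemma ctendsM f g a b : ctends f a -> ctends g b -> ctends (fun n => f n * g n) (a * b).
Proof. by move=> fa gb; exact: (@cvgM R[i] _ _ _ f g a b fa gb). Qed.

Lemma ctends_sum (J : Type) (r : seq J) (Q : pred J) (F : J -> nat -> R[i]) (A : J -> R[i]) :
  (forall j, Q j -> ctends (F j) (A j)) ->
  ctends (fun n => \sum_(j <- r | Q j) F j n) (\sum_(j <- r | Q j) A j).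
Proof.
move=> FA; elim: r => [|j r IH].
  by rewrite big_nil; under eq_fun do rewrite big_nil; exact: ctends_cst.
rewrite big_cons; under eq_fun do rewrite big_cons.
by case: ifPn => [Qj|_]; [exact: (ctendsD (FA j Qj) IH)|exact: IH].
Qed.

Lemma ctends_sum0 (J : Type) (r : seq J) (Q : pred J) (F : J -> nat -> R[i]) :
  (forall j, Q j -> ctends (F j) 0) ->
  ctends (fun n => \sum_(j <- r | Q j) F j n) 0.
Proof. by move=> /ctends_sum h; have := h r; rewrite big1_eq. Qed.

Lemma ctends_near f g a : (\forall n \near \oo, f n = g n) -> ctends g a -> ctends f a.
Proof.
move=> fg ga; rewrite /ctends; apply: cvg_trans ga.
apply: (@near_eq_cvg _ R[i]^o _ _ g f).
by apply: filterS fg => n ->.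
Qed.

Lemma ctends_real (h : nat -> R) (x : R) : h @ \oo --> x -> ctends (fun n => (h n)%:C) x%:C.
Proof.
move=> hx; apply: (proj2 (@cvgrPdist_lt R[i] R[i]^o _ _ _ (fun n => (h n)%:C) x%:C)).
(* A positive complex number is real, so the radius amounts to a positive [e] in [R]. *)
move=> [e e']; rewrite ltcE /= => /andP[/eqP e'0 e0].
have H := proj1 (@cvgrPdist_lt R R^o _ _ _ h x) hx e e0.
near=> n; have hn : `|x - h n| < e by near: n; exact: H.
rewrite -rmorphB /= normc_def /= expr0n addr0 sqrtr_sqr.
by rewrite e'0 ltcR.
Unshelve. all: by end_near.
Qed.

End ComplexSequences.

Section WordLimit.
Variables (R : realType) (p : nat) (d : 'I_p.+1 -> R).
Notation letter_type := ('I_p * bool)%type.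
Notation word_type := (seq letter_type).
Implicit Types (x : letter_type) (u s : word_type).

(* The fuel m makes the recursion structural; any m >= size u gives the same value. *)
Fixpoint word_limit_rec (m : nat) u : R :=
  if m is m'.+1 then
    if u is x :: s then
      \sum_(t < size s | nth x s t == adj x)
        d (tgt x) * (word_limit_rec m' (take t s) * word_limit_rec m' (drop t.+1 s))
    else 1
  else 1.

Definition word_limit u := word_limit_rec (size u) u.

Lemma word_limit_recE m u : (size u <= m)%N -> word_limit_rec m u = word_limit u.
Proof.
rewrite /word_limit; have [k] := ubnP (size u).
elim: k u m => // k IH [|x s] [|m] //= sk sm.
apply: eq_bigr => t _; have ts := ltn_ord t.
have s1 : (size (take t s) <= size s)%N by rewrite size_take ts ltnW.
have s2 : (size (drop t.+1 s) <= size s)%N by rewrite size_drop leq_subr.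
by rewrite !IH// ?(leq_ltn_trans s1)// ?(leq_ltn_trans s2)// ?(leq_trans s1)// ?(leq_trans s2).
Qed.

Lemma word_limit_cons x s : word_limit (x :: s) =
  \sum_(t < size s | nth x s t == adj x)
    d (tgt x) * (word_limit (take t s) * word_limit (drop t.+1 s)).
Proof.
rewrite {1}/word_limit /=; apply: eq_bigr => t _; have ts := ltn_ord t.
rewrite !word_limit_recE// ?size_drop ?leq_subr// size_take ts ltnW//.
Qed.

Variables (disp : nat -> measure_display)
  (Omega : forall n : nat, measurableType (disp n))
  (P : forall n : nat, probability (Omega n) R)
  (N : forall n : nat, 'I_p.+1 -> {set 'I_n})
  (hN : forall n : nat, (p < n)%N -> interval_partition (N n))
  (hd : forall q : 'I_p.+1,
      (fun n : nat => #|N n q|%:R / n%:R : R) @ \oo --> d q)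
  (v : 'M[R]_p.+1)
  (hv1 : forall j : 'I_p, v (widen_ord (leqnSn p) j) (lift ord0 j) = 1)
  (Y : forall n : nat, Omega n -> 'M[R[i]]_n)
  (hY : forall n : nat, (p < n)%N ->
      gaussian_block_matrix (P n) (N n) v (@Y n)).

Let ratio_tends q : ctends (fun n => #|N n q|%:R / n%:R : R[i]) (d q)%:C.
Proof.
have := ctends_real (@hd q).
congr (ctends _ _); apply/funext => n.
by rewrite fmorph_div /= !rmorph_nat.
Qed.

Let N0 n q : (p < n)%N -> (0 < #|N n q|)%N.
Proof.
by move=> pn; rewrite card_gt0; have [h _ _ _] := hN pn; exact: h.
Qed.

(** A nonempty block bounds the coefficient by [n^-1], even when the proportion of the block tends
    to 0. *)
Let merge_tends q : ctends (fun n => n%:R^-1 / #|N n q|%:R : R[i]) 0.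
Proof.
have inv0 : (fun n : nat => n%:R^-1 : R) @ \oo --> (0 : R).
  by rewrite -(cvg_shiftS _); exact: cvg_harmonic.
have h0 : (fun n : nat => n%:R^-1 / #|N n q|%:R : R) @ \oo --> (0 : R).
  apply: (squeeze_cvgr _ (cvg_cst 0) inv0).
  near=> n; have pn : (p < n)%N by near: n; exact: nbhs_infty_gt.
  rewrite mulr_ge0 ?invr_ge0//= ler_piMr ?invr_ge0//.
  by rewrite invf_le1 ?ltr0n ?N0// ler1n N0.
have := ctends_real h0.
congr (ctends _ _); apply/funext => n.
by rewrite rmorphM !fmorphV /= !rmorph_nat.
Unshelve. all: by end_near.
Qed.

(** Each trace counts one more than its length: dropping an empty trace must decrease the measure,
    and so must a split, which loses two letters but gains a trace. *)
Let weight (ws : seq ('I_p.+1 * word_type)) := sumn [seq (size k.2).+1 | k <- ws].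

Lemma tau_prod_tends ws : all (fun c => walk c.1 c.2 c.1) ws ->
  ctends (fun n => complex_expectation (P n) (fun w => tau_prod (N n) (@Y n w) ws))
    (\prod_(k <- ws) word_limit k.2)%:C.
Proof.
have [m] := ubnP (weight ws); elim: m ws => // m IH [|[q [|x s]] ws] wm /=.
- move=> _; rewrite big_nil; apply: (ctends_near (g := fun=> 1)); last exact: ctends_cst.
  apply: nearW => n; under eq_fun do rewrite /tau_prod big_nil.
  rewrite complex_expectationE /= !Rintegral_cst//= probability_setT mul0r/= mul1r.
  by [].
- rewrite eqxx /= => wws; rewrite big_cons /= [word_limit [::]]/word_limit /= mul1r.
  apply: ctends_near (IH ws _ wws); last first.
    by move: wm; rewrite /weight /= add1n ltnS.
  near=> n; have pn : (p < n)%N by near: n; exact: nbhs_infty_gt.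
  congr complex_expectation; apply/funext => w.
  rewrite {1}/tau_prod big_cons -/(tau_prod _ _ ws) /tau /block_trace /=.
  rewrite (eq_bigr (fun=> 1)); last by move=> a _; rewrite mxE eqxx.
  by rewrite sumr_const mulVf ?mul1r// pnatr_eq0 -lt0n N0.
move=> /andP[/andP[/eqP xq hs] wws]; subst q.
rewrite big_cons /= -[\prod_(k <- ws) _]/(\prod_(k <- ws) word_limit k.2).
have weight_cat ws1 ws2 : weight (ws1 ++ ws2) = (weight ws1 + weight ws2)%N.
  by rewrite /weight map_cat sumn_cat.
(* The loop equation is available for [n > p], hence the passage to an eventually equal sequence;
   the hole is filled by its right-hand side. *)
apply: (ctends_near (g := fun n => _)).
  near=> n; have pn : (p < n)%N by near: n; exact: nbhs_infty_gt.
  exact: (loop_equation (hN pn) (@hv1) (hY pn) hs wws).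
rewrite -[(_ * _)%:C]addr0; apply: ctendsD.
  rewrite word_limit_cons mulr_suml rmorph_sum/=; apply: ctends_sum => t xt.
  rewrite -mulrA rmorphM; apply: ctendsM; first exact: ratio_tends.
  have ts := ltn_ord t.
  have [h1 h2] := walk_split x ts hs.
  rewrite (eqP xt) src_adj in h1; rewrite (eqP xt) tgt_adj in h2.
  rewrite -mulrA.
  have := IH [:: (tgt x, take t s), (src x, drop t.+1 s) & ws].
  rewrite !big_cons /=; apply.
    move: wm; rewrite /weight /= size_take ts size_drop; set k := sumn _.
    by move: ts; lia.
  by rewrite h1 h2.
apply: ctends_sum0 => k _ /=; set c := nth _ _ _.
apply: ctends_sum0 => t xt.
have kws := ltn_ord k; have tc := ltn_ord t.
have hc : walk c.1 c.2 c.1 by apply: (all_nthP _ wws).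
have [h1 h2] := walk_split x tc hc.
rewrite (eqP xt) src_adj in h1; rewrite (eqP xt) tgt_adj in h2.
pose ws' := (src x, drop t.+1 c.2 ++ take t c.2 ++ s) :: take k ws ++ drop k.+1 ws.
(* The expectation of the merged product converges by induction, so the vanishing coefficient sends
   the term to 0. *)
rewrite -[X in ctends _ X](mul0r (\prod_(k <- ws') word_limit k.2)%:C).
apply: ctendsM; first exact: merge_tends.
apply: IH.
  move: wm; rewrite -{1}(cat_take_drop k ws) (drop_nth (src x, [::]) kws) -/c.
  rewrite /ws' /weight /= !map_cat /= !sumn_cat /= !size_cat size_take tc size_drop.
  by move: tc; lia.
rewrite /ws' /= all_cat; apply/andP; split; last first.
  move: wws; rewrite -{1}(cat_take_drop k ws) (drop_nth (src x, [::]) kws) -/c.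
  by rewrite all_cat /= => /and3P[-> _ ->].
(* The merged word is closed: it runs from [src x] to [c.1], on to [tgt x], and back through [s]. *)
rewrite walk_cat; apply/existsP; exists c.1; rewrite h2 /=.
by rewrite walk_cat; apply/existsP; exists (tgt x); rewrite h1.
Unshelve. all: by end_near.
Qed.

End WordLimit.

(** * Noncrossing pairings *)

Section NoncrossingPairings.
Variables (p k : nat).
Notation M := (2 * k * p)%N.
Notation lett := (@letter p k).
Implicit Types (pi : {set {set 'I_M}}) (V W : {set 'I_M}) (i j : 'I_M) (a b c : nat).

Definition compatible i j : bool :=
  ((lett i).1 == (lett j).1) && ((lett i).2 != (lett j).2).

(** Noncrossing compatible pairings of the positions from [a] up to [b] excluded. All intervals
    share the type ['I_M], so pairings of adjacent intervals are united without renumbering. *)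
Record pairing_of a b pi : Prop := PairingOf {
  pairing_block : forall V, V \in pi ->
    exists i j, [/\ V = [set i; j]%SET, (i < j)%N, (a <= i)%N, (j < b)%N & compatible i j];
  pairing_cover : forall i, (a <= i < b)%N -> exists2 V, V \in pi & i \in V;
  pairing_triv : forall V W i, V \in pi -> W \in pi -> i \in V -> i \in W -> V = W;
  pairing_nc : forall i j i' j', [set i; j]%SET \in pi -> [set i'; j']%SET \in pi ->
    (i < i')%N -> (i' < j)%N -> (j < j')%N -> False }.

Definition pairings a b : {set {set {set 'I_M}}} := [set pi | `[< pairing_of a b pi >]]%SET.

Lemma pairingsP a b pi : reflect (pairing_of a b pi) (pi \in pairings a b).
Proof. by rewrite inE; exact: asboolP. Qed.

Lemma compatibleC i j : compatible i j = compatible j i.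
Proof. by rewrite /compatible eq_sym [X in _ && ~~ X]eq_sym. Qed.

Lemma NC2E : NC2 p k = pairings 0 M.
Proof.
apply/setP => pi; apply/idP/pairingsP; rewrite inE.
- move=> /and3P[/andP[/and3P[/eqP cpi tpi _] /forall_inP sz] /forall_inP nc /forall_inP ad].
  have triv V W i : V \in pi -> W \in pi -> i \in V -> i \in W -> V = W.
    by move=> Vpi Wpi iV iW; rewrite -(def_pblock tpi Vpi iV) (def_pblock tpi Wpi iW).
  split => //.
  + move=> V Vpi; have /cards2P[i [j [ij VE]]] := sz V Vpi.
    have cij : compatible i j.
      have /forall_inP/(_ i) := ad V Vpi; rewrite VE set21 => /(_ isT)/forall_inP/(_ j).
      by rewrite set22 => /(_ isT); rewrite ij.
    have [ltij|ltji|/val_inj e] := ltngtP i j; last by rewrite e eqxx in ij.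
      by exists i, j; rewrite VE.
    by exists j, i; rewrite VE finset.setUC compatibleC.
  + move=> i _; have : i \in finset.cover pi by rewrite cpi inE.
    by move=> /bigcupP[V Vpi iV]; exists V.
  + move=> i j i' j' Vpi Wpi h1 h2 h3.
    have /forall_inP/(_ _ Wpi) := nc _ Vpi.
    have VW : [set i; j]%SET != [set i'; j']%SET.
      apply/eqP => /setP/(_ i); rewrite !inE eqxx /= => /esym/orP[] /eqP e; subst.
        by rewrite ltnn in h1.
      by move: (ltn_trans h1 (ltn_trans h2 h3)); rewrite ltnn.
    rewrite VW /= => /negP; apply.
    apply/exists_inP; exists i; rewrite ?set21//.
    apply/exists_inP; exists i'; rewrite ?set21//.
    apply/exists_inP; exists j; rewrite ?set22//.
    by apply/exists_inP; exists j'; rewrite ?set22// h1 h2.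
- move=> [bl cov triv nc]; apply/and3P; split.
  + apply/andP; split; last first.
      apply/forall_inP => V /bl[i [j [-> ij _ _ _]]]; rewrite cards2.
      by rewrite neq_ltn ij.
    apply/and3P; split.
    * apply/eqP/setP => i; rewrite inE; apply/bigcupP.
      by have [|V Vpi iV] := cov i; [rewrite ltn_ord|exists V].
    * apply/finset.trivIsetP => V W Vpi Wpi VW; rewrite -finset.setI_eq0; apply/eqP/setP => i.
      rewrite !inE; apply/negP => /andP[iV iW].
      by move: VW; rewrite (triv _ _ _ Vpi Wpi iV iW) eqxx.
    * by apply/negP => /bl[i [j [/setP/(_ i)]]]; rewrite !inE eqxx.
  + apply/forall_inP => V Vpi; apply/forall_inP => W Wpi; apply/implyP => VW.
    apply/negP => /exists_inP[i iV /exists_inP[i' i'W /exists_inP[j jV /exists_inP[j' j'W]]]].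
    move=> /andP[/andP[h1 h2] h3].
    have pairE U u u' : U \in pi -> u \in U -> u' \in U -> (u < u')%N -> U = [set u; u']%SET.
      move=> /bl[x [y [-> xy _ _ _]]]; rewrite !inE.
      by move=> /orP[] /eqP -> /orP[] /eqP -> // h; [rewrite ltnn in h|
        move: (ltn_trans h xy); rewrite ltnn|rewrite ltnn in h].
    apply: (nc i j i' j') => //.
      by rewrite -(pairE V)// (ltn_trans h1).
    by rewrite -(pairE W)// (ltn_trans h2).
  + apply/forall_inP => V /bl[x [y [-> xy _ _ cxy]]].
    apply/forall_inP => i iV; apply/forall_inP => j jV; apply/implyP => ij.
    move: iV jV ij; rewrite !inE => /orP[] /eqP -> /orP[] /eqP -> //; rewrite ?eqxx//.
    by rewrite -[_ && _]/(compatible y x) compatibleC.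
Qed.

Lemma pairing_mem a b pi V i : pairing_of a b pi -> V \in pi -> i \in V -> (a <= i < b)%N.
Proof.
move=> h /(pairing_block h)[x [y [-> xy ax yb _]]]; rewrite !inE.
move=> /orP[] /eqP ->; first by rewrite ax (ltn_trans xy).
by rewrite yb (leq_trans ax)// ltnW.
Qed.

Lemma pairing_disjoint a b a' b' pi1 pi2 V : pairing_of a b pi1 -> pairing_of a' b' pi2 ->
  (b <= a')%N -> V \in pi1 -> V \notin pi2.
Proof.
move=> h1 h2 ba V1; apply/negP => V2.
have [i [j [VE _ _ _ _]]] := pairing_block h1 V1.
have iV : i \in V by rewrite VE set21.
have /andP[_ ib] := pairing_mem h1 V1 iV.
have /andP[ai _] := pairing_mem h2 V2 iV.
by have := leq_trans ib (leq_trans ba ai); rewrite ltnn.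
Qed.

Definition pairing_join i j pi1 pi2 : {set {set 'I_M}} :=
  ([set i; j] |: (pi1 :|: pi2))%SET.

Definition pairing_restr a b pi : {set {set 'I_M}} :=
  [set V in pi | V \subset [set i : 'I_M | (a <= i < b)%N]%SET]%SET.

(** Every block lies in one of three zones: the pair itself, the positions strictly between [i] and
    [j], or those beyond [j]. Blocks from different zones neither meet nor cross. *)
Lemma pairing_joinP i j b pi1 pi2 : (i < j)%N -> (j < b)%N -> compatible i j ->
  pairing_of i.+1 j pi1 -> pairing_of j.+1 b pi2 ->
  pairing_of i b (pairing_join i j pi1 pi2).
Proof.
move=> ij jb cij h1 h2.
have memE V x : V \in pairing_join i j pi1 pi2 -> x \in V ->
    [\/ V = [set i; j]%SET /\ (x = i \/ x = j), V \in pi1 /\ (i < x < j)%N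
      | V \in pi2 /\ (j < x < b)%N].
  rewrite !inE => /or3P[/eqP -> | V1 | V2] xV.
  - by constructor 1; split => //; move: xV; rewrite !inE => /orP[] /eqP ->; [left|right].
  - by constructor 2; split => //; exact: pairing_mem h1 V1 xV.
  - by constructor 3; split => //; exact: pairing_mem h2 V2 xV.
split.
- move=> V; rewrite !inE => /or3P[/eqP -> | V1 | V2].
  + by exists i, j.
  + have [x [y [-> xy ix yj cxy]]] := pairing_block h1 V1.
    by exists x, y; split => //; [exact: ltnW|exact: ltn_trans jb].
  + have [x [y [-> xy ix yj cxy]]] := pairing_block h2 V2.
    by exists x, y; split => //; apply: leq_trans (ltnW ix); exact: ltnW.
- move=> x /andP[ix xb].
  have [xj|jx|/val_inj ->] := ltngtP x j; last first.
  + by exists [set i; j]%SET; rewrite ?set22// !inE eqxx.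
  + have [|V V2 xV] := pairing_cover h2 (i := x); first by rewrite jx xb.
    by exists V => //; rewrite !inE V2 !orbT.
  + move: ix; rewrite leq_eqVlt => /predU1P[/val_inj <-|ix].
      by exists [set i; j]%SET; rewrite ?set21// !inE eqxx.
    have [|V V1 xV] := pairing_cover h1 (i := x); first by rewrite ix xj.
    by exists V => //; rewrite !inE V1 !orbT.
- move=> V W x Vp Wp xV xW.
  have [[-> hx]|[V1 hx]|[V2 hx]] := memE V x Vp xV;
  have [[-> hx']|[W1 hx']|[W2 hx']] := memE W x Wp xW => //.
  + by case: hx => e; subst x; lia.
  + by case: hx => e; subst x; lia.
  + by case: hx' => e; subst x; lia.
  + exact: (pairing_triv h1 V1 W1 xV xW).
  + by lia.
  + by case: hx' => e; subst x; lia.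
  + by lia.
  + exact: (pairing_triv h2 V2 W2 xV xW).
- have memE2 x y : [set x; y]%SET \in pairing_join i j pi1 pi2 ->
    [\/ (x = i \/ x = j) /\ (y = i \/ y = j),
        [/\ [set x; y]%SET \in pi1, (i < x < j)%N & (i < y < j)%N]
      | [/\ [set x; y]%SET \in pi2, (j < x < b)%N & (j < y < b)%N]].
    rewrite !inE => /or3P[/eqP e | V1 | V2].
    - constructor 1; have := set21 x y; have := set22 x y; rewrite e !inE.
      by move=> /orP[] /eqP -> /orP[] /eqP ->; split; by [left|right].
    - by constructor 2; split=> //; apply: pairing_mem h1 V1 _; rewrite ?set21 ?set22.
    - by constructor 3; split=> //; apply: pairing_mem h2 V2 _; rewrite ?set21 ?set22.
  move=> x y x' y' /memE2[[e1 e2]|[V1 e1 e2]|[V1 e1 e2]]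
    /memE2[[e3 e4]|[W1 e3 e4]|[W1 e3 e4]] xx' x'y yy';
  try (by repeat match goal with h : _ \/ _ |- _ => case: h => h end; subst; lia).
  + exact: (pairing_nc h1 V1 W1 xx' x'y yy').
  + exact: (pairing_nc h2 V1 W1 xx' x'y yy').
Qed.

(** As [i] is the leftmost position, a block that does not cross the pair of [i] and [j] lies wholly
    between them or wholly to the right of [j]. *)
Lemma pairing_restrP i j b pi : pairing_of i b pi -> (i < j)%N -> [set i; j]%SET \in pi ->
  [/\ (j < b)%N, compatible i j, pairing_of i.+1 j (pairing_restr i.+1 j pi),
      pairing_of j.+1 b (pairing_restr j.+1 b pi) &
      pi = pairing_join i j (pairing_restr i.+1 j pi) (pairing_restr j.+1 b pi)].
Proof.
move=> h ij ijpi.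
have pairE (x y x' y' : 'I_M) : [set x; y]%SET = [set x'; y']%SET -> (x < y)%N -> (x' < y')%N ->
    x = x' /\ y = y'.
  move=> e xy x'y'; have := set21 x y; have := set22 x y; rewrite e !inE.
  by move=> /orP[] /eqP e1 /orP[] /eqP e2; split=> //; apply: val_inj => /=; subst; lia.
have [x [y [/pairE/(_ ij)]]] := pairing_block h ijpi.
move=> + xy; move=> /(_ xy)[e1 e2] _ jb cij; subst x y.
have sub a' b' (x y : 'I_M) : (x < y)%N ->
    ([set x; y]%SET \subset [set i : 'I_M | (a' <= i < b')%N]%SET) =
    (a' <= x)%N && (y < b')%N.
  move=> xy'; apply/fintype.subsetP/andP => [hs|[ax yb] z].
    have := hs x (set21 _ _); have := hs y (set22 _ _); rewrite !inE.
    by move=> /andP[_ ->] /andP[->].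
  rewrite !inE => /orP[] /eqP ->; first by rewrite ax (ltn_trans xy').
  by rewrite yb (leq_trans ax)// ltnW.
have dich V : V \in pi -> V <> [set i; j]%SET -> exists x y,
    [/\ V = [set x; y]%SET, (x < y)%N, compatible x y
      & (i < x)%N && (y < j)%N || (j < x)%N && (y < b)%N].
  move=> Vpi Vij; have [x [y [VE xy' ix yb cxy]]] := pairing_block h Vpi.
  have nmem z : z \in V -> z <> i /\ z <> j.
    by move=> zV; split=> e; subst z; apply: Vij; apply: (pairing_triv h Vpi ijpi zV);
      rewrite ?set21 ?set22.
  have [xi xj] : x <> i /\ x <> j by apply: nmem; rewrite VE set21.
  have [yi yj] : y <> i /\ y <> j by apply: nmem; rewrite VE set22.
  have nc := @pairing_nc _ _ _ h i j x y ijpi.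
  rewrite -VE in nc; have {}nc := nc Vpi.
  have ne (z t : 'I_M) : z <> t -> (z : nat) <> t by move=> zt /val_inj.
  move: xi xj yi yj => /ne xi /ne xj /ne yi /ne yj.
  exists x, y; split=> //.
  by have [xj'|xj'] := ltnP x j; [have [yj'|yj'] := ltnP y j|]; lia.
have sub_triv a' b' V W x : V \in pairing_restr a' b' pi -> W \in pairing_restr a' b' pi ->
    x \in V -> x \in W -> V = W.
  by rewrite !inE => /andP[Vpi _] /andP[Wpi _] xV xW; exact: (pairing_triv h Vpi Wpi xV xW).
have sub_nc a' b' x y x' y' : [set x; y]%SET \in pairing_restr a' b' pi ->
    [set x'; y']%SET \in pairing_restr a' b' pi ->
    (x < x')%N -> (x' < y)%N -> (y < y')%N -> False.
  by rewrite !inE => /andP[Vpi _] /andP[Wpi _]; exact: (pairing_nc h Vpi Wpi).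
have sub_block a' b' V : V \in pairing_restr a' b' pi ->
    exists x y, [/\ V = [set x; y]%SET, (x < y)%N, (a' <= x)%N, (y < b')%N & compatible x y].
  rewrite inE => /andP[Vpi Vs]; have [x [y [VE xy' ix yb cxy]]] := pairing_block h Vpi.
  by move: Vs; rewrite VE (sub _ _ _ _ xy') => /andP[ax yb']; exists x, y.
split=> //.
- split; [exact: sub_block| |exact: sub_triv|exact: sub_nc].
  move=> x /andP[ix xj]; have [|V Vpi xV] := pairing_cover h (i := x).
    by rewrite (ltnW ix) (ltn_trans xj).
  exists V => //; rewrite inE Vpi /=.
  have [|x' [y' [VE xy' _ hd]]] := dich V Vpi.
    by move=> VE; move: xV; rewrite VE !inE => /orP[] /eqP e; subst x; lia.
  rewrite VE sub//; move: xV; rewrite VE !inE => /orP[] /eqP e; subst x; lia.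
- split; [exact: sub_block| |exact: sub_triv|exact: sub_nc].
  move=> x /andP[jx xb]; have [|V Vpi xV] := pairing_cover h (i := x).
    by rewrite xb andbT ltnW// (ltn_trans ij).
  exists V => //; rewrite inE Vpi /=.
  have [|x' [y' [VE xy' _ hd]]] := dich V Vpi.
    by move=> VE; move: xV; rewrite VE !inE => /orP[] /eqP e; subst x; lia.
  rewrite VE sub//; move: xV; rewrite VE !inE => /orP[] /eqP e; subst x; lia.
- apply/setP => V; rewrite !inE.
  have [->|/eqP Vij] := eqVneq V [set i; j]%SET; first by rewrite ijpi.
  have [Vpi|//] := boolP (V \in pi).
  by have [x' [y' [-> xy' _ hd]]] := dich V Vpi Vij; rewrite !sub.
Qed.

(** The positions in a block tell which part it came from; together with [pairing_restrP] this makes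
    joining a bijection. *)
Lemma pairing_joinK i j b pi1 pi2 : (i < j)%N ->
  pairing_of i.+1 j pi1 -> pairing_of j.+1 b pi2 ->
  pairing_restr i.+1 j (pairing_join i j pi1 pi2) = pi1 /\
  pairing_restr j.+1 b (pairing_join i j pi1 pi2) = pi2.
Proof.
move=> ij h1 h2.
have sub a' b' V pi : pairing_of a' b' pi -> V \in pi ->
    V \subset [set i : 'I_M | (a' <= i < b')%N]%SET.
  by move=> h Vpi; apply/fintype.subsetP => x xV; rewrite inE (pairing_mem h Vpi xV).
have nsub a' b' V x : x \in V -> ~~ (a' <= x < b')%N ->
    V \subset [set i : 'I_M | (a' <= i < b')%N]%SET = false.
  move=> xV nx; apply/negP => /fintype.subsetP/(_ x xV); rewrite inE.
  by rewrite (negbTE nx).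
have ex a' b' pi V : pairing_of a' b' pi -> V \in pi -> exists2 x, x \in V & (a' <= x < b')%N.
  move=> h Vpi; have [x [y [VE _ _ _ _]]] := pairing_block h Vpi.
  by exists x; [|apply: (pairing_mem h Vpi)]; rewrite VE set21.
split; apply/setP => V; rewrite !inE.
- have [->|Vij] /= := eqVneq V [set i; j]%SET.
    rewrite (nsub _ _ _ i) ?set21 ?ltnn//; apply/esym/negP => V1.
    by have := pairing_mem h1 V1 (set21 i j); rewrite ltnn.
  have [V1|V1] /= := boolP (V \in pi1); first exact: sub h1 V1.
  apply/negP => /andP[V2]; have [x xV hx] := ex _ _ _ _ h2 V2.
  by rewrite (nsub _ _ _ x)//; lia.
- have [->|Vij] /= := eqVneq V [set i; j]%SET.
    rewrite (nsub _ _ _ j) ?set22 ?ltnn//; apply/esym/negP => V2.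
    by have := pairing_mem h2 V2 (set22 i j); rewrite ltnn.
  have [V2|V2] /= := boolP (V \in pi2); first by rewrite orbT; exact: sub h2 V2.
  apply/negP => /andP[]; rewrite orbF => V1; have [x xV hx] := ex _ _ _ _ h1 V1.
  by rewrite (nsub _ _ _ x)//; lia.
Qed.


End NoncrossingPairings.

(** * Recursion for weighted sums over noncrossing pairings *)

Section PairingSum.
Variables (R : realType) (p k : nat).
Notation M := (2 * k * p)%N.
Notation lett := (@letter p k).
Variable wt : 'I_M -> R.
Implicit Types (pi : {set {set 'I_M}}) (V W : {set 'I_M}) (i j : 'I_M) (a b c : nat).

(** On a pair this is the weight of the right leg; the product form repeats the test made in
    [right_legs]. *)
Definition block_weight V : R := \prod_(i in V | [exists j in V, (j < i)%N]) wt i.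

Definition pairing_sum a b : R :=
  \sum_(pi in pairings p k a b) \prod_(V in pi) block_weight V.

Lemma block_weight_pair i j : (i < j)%N -> block_weight [set i; j]%SET = wt j.
Proof.
move=> ij; rewrite /block_weight (big_pred1 j)// => x /=; rewrite !inE.
apply/andP/eqP => [[/orP[]/eqP -> //]|->].
  by move=> /exists_inP[y]; rewrite !inE => /orP[] /eqP ->; lia.
by rewrite eqxx orbT; split=> //; apply/exists_inP; exists i; rewrite ?set21.
Qed.

Lemma pairing_sum_nil a b : (b <= a)%N -> pairing_sum a b = 1.
Proof.
move=> ba; rewrite /pairing_sum (big_pred1 finset.set0) ?big_set0// => pi /=.
apply/pairingsP/eqP => [h|->].
  apply/setP => V; rewrite inE; apply/negP => /(pairing_block h)[i [j [_ ij ai jb _]]].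
  by lia.
split; first by move=> V; rewrite inE.
- by move=> i; lia.
- by move=> V W i; rewrite inE.
- by move=> i j i' j'; rewrite inE.
Qed.

Lemma prod_pairing_join i j b pi1 pi2 : (i < j)%N ->
  pairing_of i.+1 j pi1 -> pairing_of j.+1 b pi2 ->
  \prod_(V in pairing_join i j pi1 pi2) block_weight V =
  wt j * (\prod_(V in pi1) block_weight V * \prod_(V in pi2) block_weight V).
Proof.
move=> ij h1 h2; rewrite big_setU1/=; last first.
  rewrite inE negb_or; apply/andP; split; apply/negP => Vpi.
    by have := pairing_mem h1 Vpi (set21 i j); lia.
  by have := pairing_mem h2 Vpi (set21 i j); lia.
rewrite block_weight_pair//; congr (_ * _).
rewrite (eq_bigl [predU pi1 & pi2]); last by move=> V; rewrite !inE.
rewrite bigU//=; apply/pred0P => V /=; apply/negP => /andP[V1 V2].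
by have := pairing_disjoint h1 h2 (leqnSn j) V1; rewrite V2.
Qed.

Lemma pairing_sum_rec i b : (i < b)%N ->
  pairing_sum i b = \sum_(j : 'I_M | (i < j < b)%N && compatible i j)
     wt j * (pairing_sum i.+1 j * pairing_sum j.+1 b).
Proof.
move=> ib; rewrite /pairing_sum.
pose F pi := \prod_(V in pi) block_weight V.
(* A sum with exactly one term, the partner of [i], is inserted so that the pairings can be sorted
   by that partner. *)
transitivity (\sum_(pi in pairings p k i b)
    \sum_(j : 'I_M | (i < j)%N && ([set i; j]%SET \in pi)) F pi).
  apply: eq_bigr => pi /pairingsP h.
  have [|V Vpi iV] := pairing_cover h (i := i); first by rewrite leqnn.
  have [x [y [VE xy ix yb _]]] := pairing_block h Vpi.
  have xi : x = i.
    by move: iV; rewrite VE !inE => /orP[/eqP //|/eqP e]; subst y; lia.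
  subst x; rewrite (big_pred1 y)// => j /=.
  apply/andP/eqP => [[ij ijpi]|->]; last by rewrite xy -VE.
  have e := pairing_triv h Vpi ijpi iV (set21 _ _).
  have : y \in [set i; j]%SET by rewrite -e VE set22.
  by rewrite !inE => /orP[] /eqP yE //; move: xy; rewrite yE ltnn.
rewrite (exchange_big_dep (fun j : 'I_M => (i < j)%N))/=; last by move=> pi j _ /andP[].
rewrite [RHS](eq_bigl (fun j : 'I_M => (i < j)%N && ((j < b)%N && compatible i j))); last first.
  by move=> j; rewrite andbA.
rewrite [RHS]big_mkcondr/=; apply: eq_bigr => j ij.
rewrite ij; case: ifP => hj; last first.
  rewrite big1// => pi /andP[/pairingsP h ijpi].
  by have [jb cij _ _ _] := pairing_restrP h ij ijpi; rewrite jb cij in hj.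
have /andP[jb cij] := hj.
rewrite big_distrlr/= pair_big mulr_sumr/=.
rewrite (reindex_onto (fun pr => pairing_join i j pr.1 pr.2)
  (fun pi => (pairing_restr i.+1 j pi, pairing_restr j.+1 b pi)))/=; last first.
  by move=> pi /andP[/pairingsP h ijpi]; have [_ _ _ _ <-] := pairing_restrP h ij ijpi.
apply: eq_big => [[pi1 pi2]|[pi1 pi2]] /=.
  apply/andP/andP => [[/andP[/pairingsP h ijpi] /eqP[e1 e2]]|[/pairingsP h1 /pairingsP h2]].
    have [_ _ h1 h2 _] := pairing_restrP h ij ijpi.
    by rewrite e1 in h1; rewrite e2 in h2; split; exact/pairingsP.
  split; last by have [-> ->] := pairing_joinK ij h1 h2.
  by apply/andP; split; [apply/pairingsP; exact: pairing_joinP|rewrite !inE eqxx].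
move=> /andP[/andP[/pairingsP h ijpi] /eqP[e1 e2]].
have [_ _ h1 h2 _] := pairing_restrP h ij ijpi.
by rewrite e1 in h1; rewrite e2 in h2; exact: prod_pairing_join h1 h2.
Qed.

End PairingSum.

(** * Identification of the moment polynomial with the limit of the walk word *)

Section MomentPolynomial.
Variables (R : realType) (p k : nat) (d : 'I_p.+1 -> R).
Notation M := (2 * k * p)%N.
Notation lett := (@letter p k).
Notation letter_type := ('I_p * bool)%type.
Implicit Types (i : 'I_M).

Definition period : seq letter_type :=
  [seq (j, false) | j <- enum 'I_p] ++ [seq (j, true) | j <- rev (enum 'I_p)].

Definition walk_word : seq letter_type := flatten (nseq k period).

Definition number_letter (x : letter_type) : nat * bool := ((x.1 : nat).+1, x.2).

Lemma number_letter_adj x y :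
  ((number_letter x).1 == (number_letter y).1) &&
  ((number_letter x).2 != (number_letter y).2) = (y == adj x).
Proof.
case: x y => j b [j' b']; rewrite xpair_eqE /= eqSS eq_sym -val_eqE.
by congr (_ && _); case: b b' => [] [].
Qed.

Lemma word_walk_word : word p k = map number_letter walk_word.
Proof.
rewrite /word /walk_word map_flatten map_nseq; congr (flatten (nseq _ _)).
have iotaE : iota 1 p = map (fun j : 'I_p => (j : nat).+1) (enum 'I_p).
  by rewrite (iotaDl 1 0 p) -val_enum_ord -map_comp.
by rewrite iotaE -map_rev /period map_cat -!map_comp.
Qed.

Lemma size_walk_word : size walk_word = M.
Proof. by rewrite -(size_word p k) word_walk_word size_map. Qed.

Lemma letter_walk_word x0 i : lett i = number_letter (nth x0 walk_word i).
Proof.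
by rewrite /letter word_walk_word (nth_map x0)// size_walk_word.
Qed.

(** In the leg counts the letter [j] weighs [d_j] and [j^*] weighs [d_(j+1)]. With blocks counted
    from 0 these are the indices [j - 1] and [j], that is, the block at which the letter starts. *)
Definition block_of (l : nat * bool) : 'I_p.+1 := inord (if l.2 then l.1 else l.1.-1).

Lemma block_of_number_letter x : block_of (number_letter x) = src x.
Proof.
apply: val_inj; rewrite /block_of /number_letter /src /=.
by case: x => j [] /=; rewrite inordK// ltnS ?ltn_ord// ltnW.
Qed.

Let i_letter i : exists x, lett i = number_letter x.
Proof.
have : lett i \in word p k by apply: mem_nth; rewrite size_word.
by rewrite word_walk_word => /mapP[x _ ->]; exists x.
Qed.

(** Each position lies in a single block of [pi], so the product over blocks is a product over right
    legs, which is then sorted by the dimension that each leg contributes. *)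
Lemma prod_leg_count pi : pairing_of 0 M pi ->
  \prod_(q < p.+1) d q ^+ leg_count pi q.+1 =
  \prod_(V in pi) block_weight (fun i => d (block_of (lett i))) V.
Proof.
move=> h.
pose right i := [exists V in pi, (i \in V) && [exists j in V, (j < i)%N]].
transitivity (\prod_(i | right i) d (block_of (lett i))); last first.
  rewrite /block_weight (exchange_big_dep right)/=; last first.
    by move=> V i Vpi /andP[iV ex]; apply/exists_inP; exists V; rewrite ?iV.
  apply: eq_bigr => i /exists_inP[V Vpi /andP[iV ex]].
  rewrite (big_pred1 V)// => W /=; apply/and3P/eqP => [[Wpi iW _]|->]; last by split.
  exact: (pairing_triv h Wpi Vpi iW iV).
rewrite [RHS](partition_big (fun i => block_of (lett i)) xpredT)//=.
apply: eq_bigr => q _.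
rewrite (eq_bigr (fun=> d q)); last by move=> i /andP[_ /eqP ->].
rewrite prodr_const; congr (_ ^+ _).
(* The two sets of right legs carry different stars, so their cardinals add up to that of the
   union. *)
rewrite /leg_count -cardsUI [X in (_ + X)%N](_ : _ = 0%N) ?addn0; last first.
  apply/eqP; rewrite cards_eq0; apply/eqP/setP => i; rewrite !inE.
  by case: eqP => //= ->; rewrite xpair_eqE andbF andFb andbF.
apply: eq_card => i; rewrite !inE -/(right i) unfold_in.
have [[j b] ->] := i_letter i; rewrite block_of_number_letter -andb_orl andbC.
congr (_ && _); rewrite /number_letter /src /= !xpair_eqE.
by case: b; rewrite /= ?andbT ?andbF ?orbF ?orFb -val_eqE /= ?/bump /= ?add1n.
Qed.

(** Both sides satisfy the recursion on the partner of the first letter [x]. One weighs the right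
    leg and the other the target of [x]; they agree because the partner is [adj x] and
    [src (adj x) = tgt x]. *)
Lemma pairing_sum_word_limit a b : (a <= b <= M)%N ->
  pairing_sum (fun i : 'I_M => d (block_of (lett i))) a b =
  word_limit d (take (b - a) (drop a walk_word)).
Proof.
have [m] := ubnP (b - a); elim: m a b => // m IH a b bam /andP[ab bM].
move: ab; rewrite leq_eqVlt => /predU1P[<-|ab].
  by rewrite pairing_sum_nil// subnn take0.
have aM : (a < M)%N := leq_trans ab bM.
rewrite -[a]/(nat_of_ord (Ordinal aM)) pairing_sum_rec//=.
have [x0 _] := i_letter (Ordinal aM).
set x := nth x0 walk_word a.
have dE : drop a walk_word = x :: drop a.+1 walk_word.
  by rewrite (drop_nth x0)// size_walk_word.
rewrite dE -(subnSK ab) /= word_limit_cons.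
set s := take _ _.
have ss : size s = (b - a.+1)%N.
  by rewrite size_takel// size_drop size_walk_word leq_sub2r.
have compE (j : 'I_M) : compatible (Ordinal aM) j = (nth x0 walk_word j == adj x).
  by rewrite /compatible !(letter_walk_word x0) number_letter_adj.
pose F t := d (tgt x) * (word_limit d (take t s) * word_limit d (drop t.+1 s)).
rewrite (eq_bigl (fun j : 'I_M => (a < j < b)%N && (nth x0 walk_word j == adj x))); last first.
  by move=> j; rewrite compE.
(* Position [j] of the whole word is position [j - a.+1] of [s], which starts just after the first
   letter. *)
transitivity (\sum_(j < M | (a < j < b)%N && (nth x0 walk_word j == adj x)) F (j - a.+1)%N).
  apply: eq_bigr => j /andP[/andP[aj jb] /eqP jx].
  rewrite /F (letter_walk_word x0) block_of_number_letter jx src_adj.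
  rewrite !IH//; try lia.
  congr (_ * (word_limit d _ * word_limit d _)).
    by rewrite /s take_takel//; lia.
  rewrite /s !take_drop drop_drop subnSK// subnK// subnK//.
  by congr (drop _ _); lia.
have e t : (t < size s)%N -> nth x s t = nth x0 walk_word (t + a.+1).
  move=> ts; rewrite (set_nth_default x0)// /s nth_take ?nth_drop 1?addnC//.
  by rewrite -ss.
rewrite [RHS](eq_bigl (fun t : 'I_(size s) => nth x0 walk_word (t + a.+1) == adj x)); last first.
  by move=> t; rewrite e.
rewrite -(big_mkord (fun t => nth x0 walk_word (t + a.+1) == adj x) F) ss.
rewrite -(big_mkord (fun j => (a < j < b)%N && (nth x0 walk_word j == adj x))
  (fun j => F (j - a.+1)%N)).
transitivity (\sum_(a.+1 <= j < b | nth x0 walk_word j == adj x) F (j - a.+1)%N).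
  rewrite [RHS](big_nat_widen _ _ M)// [RHS](big_nat_widenl _ 0%N)//.
  by apply: eq_bigl => j; case: (_ == _); case: (a < j)%N; case: (j < b)%N.
rewrite -{1}[a.+1]add0n big_addn; apply: eq_bigr => t _; by rewrite addnK.
Qed.

Lemma moment_poly_word_limit : moment_poly k d = word_limit d walk_word.
Proof.
transitivity (pairing_sum (fun i : 'I_M => d (block_of (lett i))) 0 M).
  rewrite /moment_poly NC2E; apply: eq_bigr => pi /pairingsP h.
  exact: prod_leg_count.
by rewrite pairing_sum_word_limit ?leqnn// drop0 take_oversize// size_walk_word subn0.
Qed.

End MomentPolynomial.

(** * The product of the symmetric blocks *)

Section ProductWords.
Variables (R : realType) (p n : nat) (N : 'I_p.+1 -> {set 'I_n}) (A : 'M[R[i]]_n).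
Notation letter_type := ('I_p * bool)%type.
Implicit Types (x : letter_type) (u s : seq letter_type) (q r : 'I_p.+1).
Hypothesis disjN : forall q r, q != r -> N q :&: N r = finset.set0.

Let D q : 'M[R[i]]_n := block_proj R N q.

Let mulDE q (B : 'M[R[i]]_n) a b : (D q *m B) a b = (a \in N q)%:R * B a b.
Proof. by rewrite /D /block_proj mul_diag_mx !mxE. Qed.

Let mulED q (B : 'M[R[i]]_n) a b : (B *m D q) a b = B a b * (b \in N q)%:R.
Proof. by rewrite /D /block_proj mul_mx_diag !mxE. Qed.

Let projK q : D q *m D q = D q.
Proof.
by apply/matrixP => a b; rewrite mulDE /D !mxE; case: (a \in N q); rewrite ?mul1r// mul0r mul0rn.
Qed.

Let proj_orth q r : q != r -> D q *m D r = 0.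
Proof.
move=> qr; apply/matrixP => a b; rewrite mulDE !mxE.
have /setP/(_ a) := disjN qr; rewrite !inE.
by case: (a \in N q) => /= [->|_]; rewrite ?mul0rn ?mulr0 ?mul0r.
Qed.

Let tmul (B C : 'M[R[i]]_n) : (B *m C)^t* = C^t* *m B^t*.
Proof. by rewrite trmx_mul map_mxM. Qed.

Let tD q : (D q)^t* = D q.
Proof.
by apply/matrixP => a b; rewrite !mxE eq_sym; case: eqP => [->|_];
  rewrite ?mulr1n ?mulr0n ?rmorph0// rmorph_nat.
Qed.

(* Both matrices T_{j,j+1} and T_{j,j+1}^* as functions of the letters j and j^*. *)
Definition sym_letter x : 'M[R[i]]_n :=
  let S := sym_block N A (widen_ord (leqnSn p) x.1) (lift ord0 x.1) in
  if x.2 then S^t* else S.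

Definition sym_word u : 'M[R[i]]_n := foldr (fun x M => sym_letter x *m M) 1%:M u.

Lemma sym_word_cat u s : sym_word (u ++ s) = sym_word u *m sym_word s.
Proof. by elim: u => [|x u IH] /=; rewrite ?mul1mx// IH mulmxA. Qed.

(** Of the two summands of a symmetric block, the projection on the source keeps the one starting
    there and kills the other, since distinct blocks have orthogonal projections. *)
Lemma proj_sym_letter x : D (src x) *m sym_letter x = letter_mx N A x.
Proof.
have ne : widen_ord (leqnSn p) x.1 != lift ord0 x.1.
  by rewrite -val_eqE /= /bump /= add1n neq_ltn ltnSn.
have -> : letter_mx N A x = D (src x) *m (if x.2 then A^t* else A) *m D (tgt x).
  apply/matrixP => a b; rewrite mulED mulDE mxE /letter_entry -mulnb natrM mulrAC.
  by congr (_ * _ * _); case: (x.2); rewrite ?mxE.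
rewrite /sym_letter /sym_block -/(D _) -/(D _) /src /tgt; case: x.2 => /=.
  rewrite raddfD /= map_mxD !tmul !tD mulmxDr !mulmxA projK.
  by rewrite proj_orth 1?eq_sym// !mul0mx ?add0r ?addr0.
by rewrite mulmxDr !mulmxA projK proj_orth// !mul0mx addr0.
Qed.

(** A letter matrix already ends in the projection on its target, the source of the next letter, so
    one projection on the left propagates through the whole word. *)
Lemma proj_sym_word q u r : walk q u r ->
  D q *m sym_word u = D q *m word_mx N A u.
Proof.
elim: u q => [|x u IH] q //= /andP[/eqP <- h].
rewrite !mulmxA proj_sym_letter.
have E : letter_mx N A x = letter_mx N A x *m D (tgt x).
  apply/matrixP => a b; rewrite mulED mxE; case: (b \in _); rewrite ?mulr1// andbF.
  by rewrite !mul0r.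
have E' : D (src x) *m letter_mx N A x = letter_mx N A x.
  apply/matrixP => a b; rewrite mulDE mxE; case: (a \in _); rewrite ?mul1r//=.
  by rewrite !mul0r.
by rewrite E' {1}E -mulmxA (IH _ h) mulmxA -E.
Qed.

Lemma sym_word_adjoint u : (sym_word u)^t* = sym_word (rev (map (@adj p) u)).
Proof.
elim: u => [|x u IH] /=.
  apply/matrixP => a b; rewrite !mxE eq_sym; exact: rmorph_nat.
rewrite tmul IH rev_cons -cats1 sym_word_cat /= mulmx1; congr (_ *m _).
rewrite /sym_letter /=; case: x.2 => //=.
by apply/matrixP => a b; rewrite !mxE conjCK.
Qed.

Lemma sym_wordE (J : seq 'I_p) :
  sym_word [seq (j, false) | j <- J] =
  \prod_(j <- J) sym_block N A (widen_ord (leqnSn p) j) (lift ord0 j).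
Proof. by elim: J => [|j J IH]; rewrite ?big_nil ?big_cons //= IH. Qed.

(** The adjoint reverses a word and toggles its stars, so [block_product] times its adjoint is the
    word of one period. *)
Lemma sym_word_walk_word k :
  (block_product N A *m (block_product N A)^t*) ^+ k = sym_word (walk_word p k).
Proof.
have E : block_product N A = sym_word [seq (j, false) | j <- enum 'I_p].
  by rewrite sym_wordE enumT /block_product [index_enum _]unlock.
have -> : block_product N A *m (block_product N A)^t* = sym_word (period p).
  rewrite E sym_word_adjoint /period sym_word_cat; congr (_ *m sym_word _).
  by rewrite -map_comp map_rev.
by rewrite /walk_word; elim: k => // k IH; rewrite exprS IH /= sym_word_cat.
Qed.

End ProductWords.

Section WalkWord.
Variable p : nat.
Notation letter_type := ('I_p * bool)%type.
Implicit Types (u : seq letter_type) (q r : 'I_p.+1).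

Lemma walk_adjoint q u r : walk q u r -> walk r (rev (map (@adj p) u)) q.
Proof.
elim: u q => [|x u IH] q /=; first by rewrite eq_sym.
move=> /andP[/eqP <- h]; rewrite rev_cons -cats1 walk_cat.
by apply/existsP; exists (tgt x); rewrite IH//= src_adj tgt_adj !eqxx.
Qed.

Lemma walk_enum : walk ord0 [seq (j, false) | j <- enum 'I_p] (ord_max : 'I_p.+1).
Proof.
suff h m q : (m <= p)%N -> q = m :> nat ->
    walk q [seq (j, false) | j <- drop m (enum 'I_p)] ord_max.
  by have := h 0%N ord0 (leq0n _) erefl; rewrite drop0.
(* The induction runs backwards from the end of the enumeration, on [p - m]. *)
move=> mp; rewrite -(subKn mp); move: (p - m)%N (leq_subr m p) q => {m mp}.
elim=> [|m IH] mp q qm.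
  rewrite drop_oversize ?size_enum_ord ?subn0//=; apply/eqP/val_inj.
  by rewrite /= qm subn0.
have lt : (p - m.+1 < p)%N by lia.
rewrite (drop_nth (Ordinal lt)) ?size_enum_ord//= subnSK//.
have e : nth (Ordinal lt) (enum 'I_p) (p - m.+1) = Ordinal lt.
  by apply: val_inj; rewrite /= nth_enum_ord.
rewrite e; apply/andP; split; first by apply/eqP/val_inj; rewrite /= qm.
by apply: IH; [exact: ltnW|rewrite /= /bump /= add1n subnSK].
Qed.

(** Each period goes from the first block to the last and returns along the adjoint walk. *)
Lemma walk_walk_word k : walk ord0 (walk_word p k) (ord0 : 'I_p.+1).
Proof.
rewrite /walk_word; elim: k => [|k IH] /=; first by rewrite eqxx.
rewrite walk_cat; apply/existsP; exists ord0; rewrite IH andbT /period walk_cat.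
apply/existsP; exists ord_max; rewrite walk_enum /=.
by have := walk_adjoint walk_enum; rewrite -map_comp map_rev.
Qed.

End WalkWord.

Theorem theorem9p1 (R : realType) (p : nat) (hp : (0 < p)%N)
  (disp : nat -> measure_display)
  (Omega : forall n : nat, measurableType (disp n))
  (P : forall n : nat, probability (Omega n) R)
  (N : forall n : nat, 'I_p.+1 -> {set 'I_n})
  (hN : forall n : nat, (p < n)%N -> interval_partition (N n))
  (d : 'I_p.+1 -> R)
  (hd : forall q : 'I_p.+1,
      (fun n : nat => #|N n q|%:R / n%:R : R) @ \oo --> d q)
  (v : 'M[R]_p.+1) (hv_sym : v^T = v)
  (hv1 : forall j : 'I_p, v (widen_ord (leqnSn p) j) (lift ord0 j) = 1)
  (Y : forall n : nat, Omega n -> 'M[R[i]]_n)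
  (hY : forall n : nat, (p < n)%N ->
      gaussian_block_matrix (P n) (N n) v (Y n))
  (k : nat) :
  (fun n : nat =>
     partial_trace (P n) (N n ord0)
       (fun w => (block_product (N n) (Y n w) *m
                  (block_product (N n) (Y n w)) ^t*) ^+ k)
     : R[i]^o) @ \oo --> ((moment_poly k d)%:C : R[i]^o).
Proof.
rewrite moment_poly_word_limit.
have wws : all (fun c => walk c.1 c.2 c.1) [:: (ord0 : 'I_p.+1, walk_word p k)].
  by rewrite /= walk_walk_word.
have := tau_prod_tends hN hd hv1 hY wws.
rewrite big_seq1 /=; apply: ctends_near; near=> n.
(* For [n <= p] there is no partition into [p + 1] nonempty blocks; the hypotheses start at
   [n = p + 1]. *)
have pn : (p < n)%N by near: n; exact: nbhs_infty_gt.
have disjN : forall q r, q != r -> N n q :&: N n r = finset.set0.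
  by have [_ h _ _] := hN n pn.
transitivity (#|N n ord0|%:R^-1 * complex_expectation (P n)
    (fun w => block_trace (N n) (Y n w) ord0 (walk_word p k))).
  congr (_ * complex_expectation _ _); apply/funext => w.
  apply: eq_bigr => a a0; rewrite sym_word_walk_word.
  (* A diagonal entry indexed in the first block is unchanged by the projection on that block, after
     which the symmetric blocks may be replaced by the rectangular letters. *)
  have /matrixP/(_ a a) := proj_sym_word (Y n w) disjN (walk_walk_word p k).
  by rewrite !mul_diag_mx !mxE a0 !mul1r.
rewrite -(complex_expectationZ _ (cintegrable_block_trace (hN n pn) (hY n pn) _ _)).
by congr complex_expectation; apply/funext => w; rewrite /tau_prod big_seq1.
Unshelve. all: by end_near.
Qed.
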